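(* Let $X$ and $Y$ be projective schemes over $k=\overline{\mathbb{Q}}$ embedded in the same projective space $\mathbb{P}^{r-1}$. Then one can algorithmically check whether $X$ and $Y$ are projectively equivalent. That is, there is an algorithm which, given $r$ and such $X,Y\subset\mathbb{P}^{r-1}$ as input, terminates and correctly outputs whether or not $X$ and $Y$ are projectively equivalent.
   Context: Throughout $k=\overline{\mathbb{Q}}\subset\mathbb{C}$; its elements are represented by finite data for which equality and the four arithmetic operations are computable. A projective scheme $X\subset\mathbb{P}^{r-1}$ over $k$ is ''given'' by finitely many homogeneous polynomials $f_1,\dots,f_l\in k[x_1,\dots,x_r]$ such that $X$ is the closed subscheme of $\mathbb{P}^{r-1}=\operatorname{Proj}k[x_1,\dots,x_r]$ defined by the ideal $(f_1,\dots,f_l)$. Two projective schemes $X,Y\subset\mathbb{P}^{r-1}$ are projectively equivalent if there exists an invertible matrix $g\in\mathrm{GL}_r(k)$ such that $g(X)=Y$ (equality of closed subschemes), where $\mathrm{GL}_r$ acts on $\mathbb{P}^{r-1}$ in the natural way. *)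

(* Defs.v *)
From HB Require Import structures.
From mathcomp Require Import all_boot all_order all_algebra all_field.
From mathcomp Require Import mpoly.

Set Implicit Arguments.
Unset Strict Implicit.
Unset Printing Implicit Defensive.

Import GRing.Theory.
Local Open Scope ring_scope.

(** ** Computability *)

(* Kleene's class of total recursive functions: minimization is only applied
   to regular functions ([rec_mu] requires a root for every [v]).  The
   equational side conditions make the class closed under pointwise equality. *)
Inductive recursive : forall n : nat, (n.-tuple nat -> nat) -> Prop :=
| rec_zero : recursive (fun _ : 0.-tuple nat => 0%N)
| rec_succ : recursive (fun v : 1.-tuple nat => (thead v).+1)
| rec_proj n (i : 'I_n) : recursive (fun v : n.-tuple nat => tnth v i)
| rec_comp n m (f : m.-tuple nat -> nat) (g : 'I_m -> n.-tuple nat -> nat)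
           (h : n.-tuple nat -> nat) :
    recursive f -> (forall i, recursive (g i)) ->
    (forall v, h v = f [tuple g i v | i < m]) ->
    recursive h
| rec_prim n (f : n.-tuple nat -> nat) (g : n.+2.-tuple nat -> nat)
           (h : n.+1.-tuple nat -> nat) :
    recursive f -> recursive g ->
    (forall v : n.-tuple nat, h [tuple of 0%N :: v] = f v) ->
    (forall (y : nat) (v : n.-tuple nat),
        h [tuple of y.+1 :: v] = g [tuple of y :: h [tuple of y :: v] :: v]) ->
    recursive h
| rec_mu n (f : n.+1.-tuple nat -> nat) (h : n.-tuple nat -> nat) :
    recursive f ->
    (forall v : n.-tuple nat, f [tuple of h v :: v] = 0%N) ->
    (forall (v : n.-tuple nat) (y : nat),
        (y < h v)%N -> f [tuple of y :: v] <> 0%N) ->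
    recursive h.

(* A representation of the field of algebraic numbers by finite data (numbered
   by natural numbers) with computable equality and arithmetic.  [nu] need not
   be injective.  Division is only constrained for nonzero divisors. *)
Record computable_representation (nu : nat -> algC) : Prop := {
  repr_surj : forall x : algC, exists c : nat, nu c = x;
  repr_eq : exists2 e : 2.-tuple nat -> nat, recursive e &
    forall a b : nat, e [tuple a; b] = nat_of_bool (nu a == nu b);
  repr_add : exists2 f : 2.-tuple nat -> nat, recursive f &
    forall a b : nat, nu (f [tuple a; b]) = nu a + nu b;
  repr_sub : exists2 f : 2.-tuple nat -> nat, recursive f &
    forall a b : nat, nu (f [tuple a; b]) = nu a - nu b;
  repr_mul : exists2 f : 2.-tuple nat -> nat, recursive f &
    forall a b : nat, nu (f [tuple a; b]) = nu a * nu b;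
  repr_div : exists2 f : 2.-tuple nat -> nat, recursive f &
    forall a b : nat, nu b != 0 -> nu (f [tuple a; b]) = nu a / nu b
}.

(** ** Finite descriptions of systems of polynomials *)

(* A polynomial is a list of terms (coefficient, exponents); a system is a
   list of polynomials. *)
Definition term_data : Type := nat * seq nat.
Definition poly_data : Type := seq term_data.
Definition system_data : Type := seq poly_data.

(* Exponent lists are implicitly padded with zeros, or truncated, to length r. *)
Definition poly_of (nu : nat -> algC) (r : nat) (p : poly_data) :
    {mpoly algC[r]} :=
  \sum_(t <- p) nu t.1 *: 'X_[ [multinom nth 0%N t.2 i | i < r] ].

Definition system_of (nu : nat -> algC) (r : nat) (F : system_data) :
    seq {mpoly algC[r]} :=
  [seq poly_of nu r p | p <- F].

(* [CodeSeq.code] is an explicit computable bijection from lists of natural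
   numbers to natural numbers. *)
Definition code_term (t : term_data) : nat := CodeSeq.code (t.1 :: t.2).
Definition code_poly (p : poly_data) : nat :=
  CodeSeq.code [seq code_term t | t <- p].
Definition code_system (F : system_data) : nat :=
  CodeSeq.code [seq code_poly p | p <- F].

(** ** Closed subschemes of projective space *)

Definition homogeneous_system (r : nat) (F : seq {mpoly algC[r]}) : Prop :=
  forall f, f \in F -> exists d : nat, f \is d.-homog.

Definition in_ideal (r : nat) (F : seq {mpoly algC[r]}) (p : {mpoly algC[r]}) :
    Prop :=
  exists c : 'I_(size F) -> {mpoly algC[r]}, p = \sum_i c i * F`_i.

(* For h nonzero homogeneous of degree d > 0, the sections over the basic open
   subset D_+(h) of the ideal sheaf of the subscheme of Proj k[x_1..x_r]
   defined by I = (F): the ideal I_(h) = { a / h^n | a in I homogeneous of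
   degree n d } of S_(h), the latter being seen inside the fraction field. *)
Definition ideal_sheaf (r : nat) (F : seq {mpoly algC[r]})
    (d : nat) (h : {mpoly algC[r]}) (q : {fraction {mpoly algC[r]}}) : Prop :=
  exists (n : nat) (a : {mpoly algC[r]}),
    [/\ a \is (n * d)%N.-homog, in_ideal F a & q = tofrac a / tofrac h ^+ n].

(* Closed subschemes are equal iff their ideal sheaves are, and the D_+(h) form
   a basis of the topology of Proj. *)
Definition same_subscheme (r : nat) (F G : seq {mpoly algC[r]}) : Prop :=
  forall (d : nat) (h : {mpoly algC[r]}),
    (0 < d)%N -> h != 0 -> h \is d.-homog ->
    forall q, ideal_sheaf F d h q <-> ideal_sheaf G d h q.

(* p(M x) for a column vector x of variables. *)
Definition subst_linear (r : nat) (M : 'M[algC]_r) (p : {mpoly algC[r]}) :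
    {mpoly algC[r]} :=
  p \mPo [tuple \sum_(j < r) M i j *: 'X_j | i < r].

(* Equations of g(X), where X is defined by F: since x is in g(X) iff g^-1 x is
   in X, these are the f(g^-1 x). *)
Definition translate (r : nat) (g : 'M[algC]_r) (F : seq {mpoly algC[r]}) :
    seq {mpoly algC[r]} :=
  [seq subst_linear (invmx g) f | f <- F].

Definition projectively_equivalent (r : nat) (F G : seq {mpoly algC[r]}) :
    Prop :=
  exists2 g : 'M[algC]_r, g \in unitmx & same_subscheme (translate g F) G.

(* Main.v *)
Require Import Defs.
From HB Require Import structures.
From Stdlib Require Import ClassicalEpsilon.
From mathcomp Require Import all_boot all_order all_algebra all_field.
From mathcomp Require Import mpoly ring zify.

(** Both equivalence and non-equivalence have finite certificates that can be
    checked by a recursive function, so that a blind search decides.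

    A change of coordinates M identifies the two subschemes iff, for large N,
    all x_i^N f(M^-1 x) lie in the ideal of G and all x_i^N h(M x) lie in the
    ideal of F; cofactors certify this.  For the converse, call "matrix point"
    of a subscheme a tuple A of commuting matrices over k, one of them
    invertible, which annihilates its equations.  Polynomial rings being
    residually finite (Krull intersection and the Nullstellensatz), these points
    detect membership in the saturated ideal, so M identifies the subschemes
    iff f(M^-1 A) = 0 at all matrix points A of the second one, and
    h(M A) = 0 at those of the first one.  These are polynomial equations in the
    entries of M and M^-1; by the Nullstellensatz they have no solution iff
    finitely many of them generate the unit ideal, and this again is certified
    by cofactors.

    Polynomial identities are never expanded: they are checked by evaluation on
    the grid {0, ..., D}^m, where D exceeds the codes of all the data, hence the
    degrees. *)

Set Implicit Arguments.
Unset Strict Implicit.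
Unset Printing Implicit Defensive.

(** * Recursive functions and codes *)

(** Points with values in k see only the reduced subschemes, whereas the equality asked for is one
    of ideal sheaves; nilpotents are what forces matrices as values. Since the matrices have all
    sizes, the equations on M form an infinite family, and that finitely many of them suffice is
    known only classically, through noetherianity, with no bound in sight. Hence the search for both
    answers: classical reasoning may be used freely to show that certificates exist, and only the
    checkers have to be recursive. About [nu] nothing is known but its arithmetic and its equality
    test, so the checkers do nothing but evaluate. The coding is chosen so that a code is at least
    the code of each of its parts, and at least the sum of the entries of a list of exponents;
    degree bounds are then read off the codes. The inverse of M is a second unknown matrix, which
    keeps all conditions polynomial. *)

Lemma recursive_ext n (f g : n.-tuple nat -> nat) :
  recursive f -> f =1 g -> recursive g.
Proof.
move=> rf fg; apply: (rec_comp (g := fun i v => tnth v i) rf) => [i|v].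
  exact: rec_proj.
by rewrite -fg; congr f; apply: eq_from_tnth => i; rewrite tnth_mktuple.
Qed.

(** Functions on lists avoid the dependent length of tuples: composition becomes [map], projection
    becomes [nth], and only the values on lists of length [n] count. *)
Definition recursive_seq n (f : seq nat -> nat) :=
  recursive (fun v : n.-tuple nat => f v).

Lemma recursive_seq_ext n (f g : seq nat -> nat) :
  recursive_seq n f -> (forall s, size s = n -> f s = g s) -> recursive_seq n g.
Proof. by move=> rf fg; apply: recursive_ext rf _ => v; rewrite fg ?size_tuple. Qed.

Lemma recursive_seq_zero n : recursive_seq n (fun=> 0).
Proof.
apply: (rec_comp (g := fun (i : 'I_0) (v : n.-tuple nat) => 0) rec_zero) => //.
by case.
Qed.

Lemma recursive_seq_nth n i : recursive_seq n (nth 0 ^~ i).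
Proof.
case: (ltnP i n) => lin.
  by apply: (recursive_ext (rec_proj (Ordinal lin))) => v; rewrite (tnth_nth 0).
apply: recursive_ext (recursive_seq_zero n) _ => v.
by rewrite nth_default ?size_tuple.
Qed.

Lemma recursive_seq_comp n (f : seq nat -> nat) (gs : seq (seq nat -> nat)) :
    recursive_seq (size gs) f ->
    (forall i, i < size gs -> recursive_seq n (nth (fun=> 0) gs i)) ->
  recursive_seq n (fun s => f [seq g s | g <- gs]).
Proof.
move=> rf rg.
apply: (rec_comp (g := fun (i : 'I_(size gs)) (v : n.-tuple nat) =>
                   nth (fun=> 0) gs i v) rf) => [i|v]; first exact: rg.
congr f; apply: (@eq_from_nth _ 0) => [|i]; first by rewrite size_map size_tuple.
rewrite size_map => lti; rewrite (nth_map (fun=> 0)) //.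
by rewrite -(tnth_nth 0 _ (Ordinal lti)) tnth_mktuple.
Qed.

Lemma recursive_seq_rec n (f g : seq nat -> nat) :
    recursive_seq n f -> recursive_seq n.+2 g ->
  recursive_seq n.+1 (fun s => nat_rect (fun=> nat) (f (behead s))
     (fun k acc => g [:: k, acc & behead s]) (head 0 s)).
Proof. by move=> rf rg; apply: (rec_prim rf rg). Qed.

Lemma recursive_seq_mu n (f : seq nat -> nat) (h : seq nat -> nat) :
    recursive_seq n.+1 f ->
    (forall s, size s = n -> f (h s :: s) = 0) ->
    (forall s y, size s = n -> y < h s -> f (y :: s) <> 0) ->
  recursive_seq n h.
Proof.
by move=> rf f0 fmin; apply: (rec_mu rf) => v *;
  [apply: f0 | apply: fmin] => //; rewrite size_tuple.
Qed.

Definition recursive1 (f : nat -> nat) := recursive_seq 1 (fun s => f (nth 0 s 0)).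
Definition recursive2 (f : nat -> nat -> nat) :=
  recursive_seq 2 (fun s => f (nth 0 s 0) (nth 0 s 1)).

Lemma recursive_seq_comp1 n f a : recursive1 f -> recursive_seq n a ->
  recursive_seq n (fun s => f (a s)).
Proof.
by move=> rf ra; apply: (@recursive_seq_comp n (fun s => f (nth 0 s 0)) [:: a]) => // [[]].
Qed.

Lemma recursive_seq_comp2 n f a b : recursive2 f ->
    recursive_seq n a -> recursive_seq n b ->
  recursive_seq n (fun s => f (a s) (b s)).
Proof.
move=> rf ra rb.
apply: (@recursive_seq_comp n (fun s => f (nth 0 s 0) (nth 0 s 1)) [:: a; b]) => //.
by case=> // [[]].
Qed.

Lemma recursive1_succ : recursive1 S.
Proof. by apply: recursive_ext rec_succ _ => v; rewrite -(tnth_nth 0 v ord0). Qed.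

Lemma recursive2_rec (a : nat -> nat) (g : nat -> nat -> nat -> nat) :
    recursive1 a ->
    recursive_seq 3 (fun s => g (nth 0 s 0) (nth 0 s 1) (nth 0 s 2)) ->
  recursive2 (fun m x => nat_rect (fun=> nat) (a x) (fun k acc => g k acc x) m).
Proof.
move=> ra rg; apply: recursive_seq_ext (recursive_seq_rec ra rg) _.
by case=> [|m [|x []]].
Qed.

Lemma recursive2_swap f : recursive2 f -> recursive2 (fun x y => f y x).
Proof.
by move=> rf; apply: (recursive_seq_comp2 rf); apply: recursive_seq_nth.
Qed.

Lemma recursive2_ext f g : recursive2 f -> f =2 g -> recursive2 g.
Proof. by move=> rf fg; apply: recursive_seq_ext rf _ => s _; rewrite fg. Qed.

Lemma recursive2_add : recursive2 addn.
Proof.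
apply: recursive2_ext (@recursive2_rec id (fun _ acc _ => acc.+1) _ _) _.
- exact: recursive_seq_nth.
- exact: (recursive_seq_comp1 recursive1_succ (recursive_seq_nth _ _)).
by elim=> //= m IHm x; rewrite IHm addSn.
Qed.

Lemma recursive2_mul : recursive2 muln.
Proof.
apply: recursive2_ext (@recursive2_rec (fun=> 0) (fun _ acc x => x + acc) _ _) _.
- exact: recursive_seq_zero.
- exact: (recursive_seq_comp2 recursive2_add (recursive_seq_nth _ _)
            (recursive_seq_nth _ _)).
by elim=> //= m IHm x; rewrite IHm mulSn.
Qed.

Lemma recursive1_pred : recursive1 predn.
Proof.
have r := @recursive2_rec (fun=> 0) (fun k _ _ => k) (recursive_seq_zero _)
  (recursive_seq_nth _ _).
have r1 := recursive_seq_comp2 r (recursive_seq_nth 1 0) (recursive_seq_nth 1 0).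
by apply: recursive_seq_ext r1 _ => s _; case: (nth 0 s 0).
Qed.

Lemma recursive2_sub : recursive2 subn.
Proof.
have r := @recursive2_rec id (fun _ acc _ => acc.-1) (recursive_seq_nth _ _)
   (recursive_seq_comp1 recursive1_pred (recursive_seq_nth _ _)).
apply: recursive2_ext (recursive2_swap r) _.
by move=> x; elim=> [|y IHy] /=; rewrite ?subn0 // IHy subnS.
Qed.

Lemma recursive_seq_const n c : recursive_seq n (fun=> c).
Proof.
elim: c => [|c IHc]; first exact: recursive_seq_zero.
exact: (recursive_seq_comp1 recursive1_succ IHc).
Qed.

Lemma recursive1_exp2 : recursive1 (expn 2).
Proof.
have r := @recursive2_rec (fun=> 1) (fun _ acc _ => acc + acc) (recursive_seq_const _ _)
   (recursive_seq_comp2 recursive2_add (recursive_seq_nth _ _) (recursive_seq_nth _ _)).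
have r1 := recursive_seq_comp2 r (recursive_seq_nth 1 0) (recursive_seq_nth 1 0).
apply: recursive_seq_ext r1 _ => s _.
by elim: (nth 0 s 0) => // m /= ->; rewrite expnS mul2n addnn.
Qed.

(** The cons step of [CodeSeq.code]: 0 codes the empty list, and every positive number is the pair
    of its head and its tail. The same pairing serves for products. *)
Definition cpair x y := 2 ^ x * y.*2.+1.
Definition chead c := head 0 (CodeSeq.decode c).
Definition ctail c := CodeSeq.code (behead (CodeSeq.decode c)).

Lemma cpair_code x s : cpair x (CodeSeq.code s) = CodeSeq.code (x :: s).
Proof. by []. Qed.

Lemma cheadE x y : chead (cpair x y) = x.
Proof. by rewrite -[y]CodeSeq.decodeK cpair_code /chead CodeSeq.codeK. Qed.

Lemma ctailE x y : ctail (cpair x y) = y.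
Proof. by rewrite -{1}[y]CodeSeq.decodeK cpair_code /ctail CodeSeq.codeK /= CodeSeq.decodeK. Qed.

Lemma cpairK c : c != 0 -> cpair (chead c) (ctail c) = c.
Proof.
rewrite -{1 4}[c]CodeSeq.decodeK /chead /ctail; case: (CodeSeq.decode c) => //= x s _.
Qed.

Lemma ltn_cpair x y : y < cpair x y.
Proof.
by apply: leq_trans (leq_pmull _ _); rewrite ?expn_gt0 // ltnS -addnn leq_addr.
Qed.

Lemma ltn_cpair1 x y : x < cpair x y.
Proof. exact: leq_trans (ltn_expl x _) (leq_pmulr _ _). Qed.

(** The additive bound lets the code of a list of exponents dominate the total degree. *)
Lemma leq_cpairD x y : x + y <= cpair x y.
Proof.
rewrite /cpair mulnS leq_add ?(ltnW (ltn_expl _ _)) //.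
by apply: leq_trans (leq_pmull _ _); rewrite ?expn_gt0 // -addnn leq_addr.
Qed.

Lemma recursive2_cpair : recursive2 cpair.
Proof.
apply: (recursive_seq_comp2 recursive2_mul).
  exact: (recursive_seq_comp1 recursive1_exp2 (recursive_seq_nth _ _)).
apply: (recursive_seq_comp1 recursive1_succ).
have := (recursive_seq_comp2 recursive2_add (recursive_seq_nth 2 1) (recursive_seq_nth 2 1)).
by move=> r; apply: recursive_seq_ext r _ => s _; rewrite addnn.
Qed.

Definition natdist x y := (x - y) + (y - x).

Lemma recursive2_natdist : recursive2 natdist.
Proof.
apply: (recursive_seq_comp2 recursive2_add recursive2_sub).
exact: recursive2_swap recursive2_sub.
Qed.

(** For [c] nonzero, its head is the only [x] with [c = cpair x k] for some [k < c]. The bounded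
    search for [k] is a product of distances, hence primitive recursive. The factor [c] provides a
    root when [c = 0], where the head is 0 by default. *)
Lemma recursive1_chead : recursive1 chead.
Proof.
pose t m x c := nat_rect (fun=> nat) 1 (fun k acc => acc * natdist c (cpair x k)) m.
have tP m x c : reflect (exists2 y, y < m & c = cpair x y) (t m x c == 0).
  apply: (iffP idP) => [|[y]]; elim: m => //= m IHm.
    rewrite muln_eq0 => /orP[/IHm[y ltym ->]|]; first by exists y => //; apply: leqW.
    by move=> d0; exists m => //; move: d0; rewrite /natdist; lia.
  rewrite ltnS leq_eqVlt muln_eq0 => /orP[/eqP-> ->|ltym cE].
    by rewrite /natdist subnn eqxx orbT.
  by rewrite IHm.
have rt : recursive_seq 3 (fun s => t (nth 0 s 0) (nth 0 s 1) (nth 0 s 2)).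
  have rg : recursive_seq 4
      (fun s => nth 0 s 1 * natdist (nth 0 s 3) (cpair (nth 0 s 2) (nth 0 s 0))).
    apply: (recursive_seq_comp2 recursive2_mul (recursive_seq_nth _ _)).
    apply: (recursive_seq_comp2 recursive2_natdist (recursive_seq_nth _ _)).
    by apply: (recursive_seq_comp2 recursive2_cpair); apply: recursive_seq_nth.
  apply: recursive_seq_ext (recursive_seq_rec (recursive_seq_const _ 1) rg) _.
  by case=> [|m [|x [|c []]]].
apply: (@recursive_seq_mu 1 (fun s => nth 0 s 1 * t (nth 0 s 1) (nth 0 s 0) (nth 0 s 1))).
- apply: (recursive_seq_comp2 recursive2_mul (recursive_seq_nth _ _)).
  apply: (@recursive_seq_comp 2 _ [:: nth 0 ^~ 1; nth 0 ^~ 0; nth 0 ^~ 1] rt).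
  by case=> [|[|[|]]] // _; apply: recursive_seq_nth.
- move=> [|c []] //= _; have [->//|c0] := eqVneq c 0.
  apply/eqP; rewrite muln_eq0; apply/orP; right; apply/tP; exists (ctail c).
    by rewrite -{2}(cpairK c0) ltn_cpair.
  by rewrite cpairK.
- move=> [|c []] //= y _ lty /eqP; rewrite muln_eq0 => /orP[/eqP c0|/tP[z _ cE]].
    by rewrite c0 in lty.
  by move: lty; rewrite cE cheadE ltnn.
Qed.

(** Once the head is known, a single [y] satisfies [c = cpair (chead c) y] if [c] is nonzero; the
    factor [c] again covers [c = 0]. *)
Lemma recursive1_ctail : recursive1 ctail.
Proof.
apply: (@recursive_seq_mu 1
  (fun s => nth 0 s 1 * natdist (nth 0 s 1) (cpair (chead (nth 0 s 1)) (nth 0 s 0)))).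
- apply: (recursive_seq_comp2 recursive2_mul (recursive_seq_nth _ _)).
  apply: (recursive_seq_comp2 recursive2_natdist (recursive_seq_nth _ _)).
  apply: (recursive_seq_comp2 recursive2_cpair); last exact: recursive_seq_nth.
  exact: (recursive_seq_comp1 recursive1_chead (recursive_seq_nth _ _)).
- move=> [|c []] //= _; have [->//|c0] := eqVneq c 0.
  by rewrite cpairK // /natdist subnn muln0.
- move=> [|c []] //= y _ lty /eqP; rewrite muln_eq0 => /orP[/eqP c0|cE].
    by rewrite c0 in lty.
  have {}cE: c = cpair (chead c) y by move: cE; rewrite /natdist; lia.
  by move: lty; rewrite cE ctailE ltnn.
Qed.

(** * Coded types and computable functions between them *)

Class coded (T : Type) := Coded {
  enc : T -> nat;
  dec : nat -> T;
  encK : cancel enc dec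
}.
#[global] Arguments encK {T _} _.

#[global] Instance coded_nat : coded nat := {| enc := id; dec := id; encK := fun _ => erefl |}.

Lemma bool_encK : cancel nat_of_bool (fun c => c != 0).
Proof. by case. Qed.
#[global] Instance coded_bool : coded bool := {| encK := bool_encK |}.

(* This coding of pairs makes [enc] agree with [code_system]. *)
Lemma pair_encK (T U : Type) (cT : coded T) (cU : coded U) :
  cancel (fun p : T * U => cpair (enc p.1) (enc p.2))
    (fun c => (dec (chead c), dec (ctail c))).
Proof. by case=> x y; rewrite cheadE ctailE !encK. Qed.
#[global] Instance coded_pair T U (cT : coded T) (cU : coded U) : coded (T * U) :=
  {| encK := pair_encK cT cU |}.

Lemma seq_encK (T : Type) (cT : coded T) :
  cancel (fun s : seq T => CodeSeq.code (map enc s))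
    (fun c => map dec (CodeSeq.decode c)).
Proof. by move=> s; rewrite CodeSeq.codeK (mapK encK). Qed.
#[global] Instance coded_seq T (cT : coded T) : coded (seq T) :=
  {| encK := seq_encK cT |}.

Lemma enc_pair T U {cT : coded T} {cU : coded U} (x : T) (y : U) :
  enc (x, y) = cpair (enc x) (enc y).
Proof. by []. Qed.

Lemma enc_cons T {cT : coded T} (x : T) s : enc (x :: s) = cpair (enc x) (enc s).
Proof. by []. Qed.

Lemma enc_head T U {cT : coded T} {cU : coded U} (p : T * U) : chead (enc p) = enc p.1.
Proof. by case: p => x y; rewrite enc_pair cheadE. Qed.

Lemma enc_tail T U {cT : coded T} {cU : coded U} (p : T * U) : ctail (enc p) = enc p.2.
Proof. by case: p => x y; rewrite enc_pair ctailE. Qed.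

(** Functions of several arguments are treated as functions of one common context, which a bound
    variable extends by a product. [F] is constrained on codes only. *)
Definition computable (T U : Type) (cT : coded T) (cU : coded U) (f : T -> U) :=
  exists2 F : nat -> nat, recursive1 F & forall t, enc (f t) = F (enc t).
Arguments computable {T U cT cU}.

Section Computable.
Context {X : Type} {cX : coded X}.

Lemma computable_ext U {cU : coded U} (f g : X -> U) :
  computable f -> f =1 g -> computable g.
Proof. by case=> F rF FE fg; exists F => // z; rewrite -fg. Qed.

Lemma computable_id : computable (fun z : X => z).
Proof. by exists id => //; apply: recursive_seq_nth. Qed.

Lemma computable_const U {cU : coded U} (u : U) : computable (fun _ : X => u).
Proof. by exists (fun=> enc u) => //; apply: recursive_seq_const. Qed.

Lemma computable_comp T U {cT : coded T} {cU : coded U} (f : T -> U) (g : X -> T) :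
  computable f -> computable g -> computable (fun z => f (g z)).
Proof.
case=> F rF FE [G rG GE]; exists (F \o G) => [|z]; last by rewrite FE GE.
exact: recursive_seq_comp1 rF rG.
Qed.

Lemma computable_op1 T U {cT : coded T} {cU : coded U} (f : T -> U) (F : nat -> nat)
    (a : X -> T) :
  recursive1 F -> (forall t, enc (f t) = F (enc t)) -> computable a ->
  computable (fun z => f (a z)).
Proof. by move=> rF FE; apply: computable_comp; exists F. Qed.

Lemma computable_op2 T U V {cT : coded T} {cU : coded U} {cV : coded V}
    (f : T -> U -> V) (F : nat -> nat -> nat) (a : X -> T) (b : X -> U) :
  recursive2 F -> (forall t u, enc (f t u) = F (enc t) (enc u)) ->
  computable a -> computable b -> computable (fun z => f (a z) (b z)).
Proof.
move=> rF FE [A rA AE] [B rB BE]; exists (fun c => F (A c) (B c)) => [|z].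
  exact: recursive_seq_comp2 rF rA rB.
by rewrite FE AE BE.
Qed.

Lemma computable_fst T U {cT : coded T} {cU : coded U} (a : X -> T * U) :
  computable a -> computable (fun z => (a z).1).
Proof. by apply: computable_op1 recursive1_chead _ => p; rewrite enc_head. Qed.

Lemma computable_snd T U {cT : coded T} {cU : coded U} (a : X -> T * U) :
  computable a -> computable (fun z => (a z).2).
Proof. by apply: computable_op1 recursive1_ctail _ => p; rewrite enc_tail. Qed.

Lemma computable_pair T U {cT : coded T} {cU : coded U} (a : X -> T) (b : X -> U) :
  computable a -> computable b -> computable (fun z => (a z, b z)).
Proof. by apply: (computable_op2 recursive2_cpair). Qed.

Lemma computable_succ (a : X -> nat) : computable a -> computable (fun z => (a z).+1).
Proof. by apply: (computable_op1 recursive1_succ). Qed.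

Lemma computable_addn (a b : X -> nat) :
  computable a -> computable b -> computable (fun z => a z + b z).
Proof. by apply: (computable_op2 recursive2_add). Qed.

Lemma computable_muln (a b : X -> nat) :
  computable a -> computable b -> computable (fun z => a z * b z).
Proof. by apply: (computable_op2 recursive2_mul). Qed.

Lemma computable_enc T {cT : coded T} (a : X -> T) :
  computable a -> computable (fun z => enc (a z)).
Proof. by apply: (computable_op1 (F := id)); first exact: recursive_seq_nth. Qed.

Lemma computable_if T {cT : coded T} (b : X -> bool) (f g : X -> T) :
    computable b -> computable f -> computable g ->
  computable (fun z => if b z then f z else g z).
Proof.
case=> B rB BE [F rF FE] [G rG GE].
exists (fun c => B c * F c + (1 - B c) * G c) => [|z].
  apply: (recursive_seq_comp2 recursive2_add).
    exact: (recursive_seq_comp2 recursive2_mul).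
  apply: (recursive_seq_comp2 recursive2_mul) => //.
  exact: (recursive_seq_comp2 recursive2_sub (recursive_seq_const _ _)).
by rewrite -BE -FE -GE /=; case: (b z); rewrite ?mul1n ?mul0n ?addn0.
Qed.

Lemma computable_rec T {cT : coded T} (m : X -> nat) (a : X -> T)
    (f : X -> nat -> T -> T) :
    computable m -> computable a ->
    computable (fun p : X * nat * T => f p.1.1 p.1.2 p.2) ->
  computable (fun z => nat_rect (fun=> T) (a z) (fun k acc => f z k acc) (m z)).
Proof.
case=> M rM ME [A rA AE] [F rF FE].
exists (fun c => nat_rect (fun=> nat) (A c) (fun k acc => F (cpair (cpair c k) acc)) (M c)).
  apply: (recursive_seq_comp2 (f := fun m c => nat_rect (fun=> nat) (A c)
           (fun k acc => F (cpair (cpair c k) acc)) m) _ rM (recursive_seq_nth _ _)).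
  apply: (recursive2_rec rA (g := fun k acc c => F (cpair (cpair c k) acc))).
  apply: (recursive_seq_comp1 rF).
  apply: (recursive_seq_comp2 recursive2_cpair); last exact: recursive_seq_nth.
  by apply: (recursive_seq_comp2 recursive2_cpair); apply: recursive_seq_nth.
by move=> z; rewrite -ME /=; elim: (m z) => //= k IHk; rewrite -IHk -(FE (z, k, _)).
Qed.

Lemma computable_iter T {cT : coded T} (m : X -> nat) (a : X -> T) (f : X -> T -> T) :
    computable m -> computable a -> computable (fun p : X * T => f p.1 p.2) ->
  computable (fun z => iter (m z) (f z) (a z)).
Proof.
move=> cm ca cf; apply: computable_ext (computable_rec cm ca (f := fun z _ => f z) _) _.
  by case: cf => F rF FE; exists (fun c => F (cpair (chead (chead c)) (ctail c)));
  [apply: (recursive_seq_comp1 rF); apply: (recursive_seq_comp2 recursive2_cpair);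
     [apply: (recursive_seq_comp1 recursive1_chead)|];
     apply: (recursive_seq_comp1 _ (recursive_seq_nth _ _));
     [exact: recursive1_chead | exact: recursive1_ctail]
  |move=> [[z k] t]; rewrite (FE (z, t)) !enc_pair !cheadE ctailE].
by move=> z; elim: (m z) => //= k ->.
Qed.

Lemma computable_eqn (a b : X -> nat) :
  computable a -> computable b -> computable (fun z => a z == b z).
Proof.
move=> ca cb; apply: (computable_op2 (F := fun x y => 1 - ((x - y) + (y - x)))) => //.
  apply: (recursive_seq_comp2 recursive2_sub (recursive_seq_const _ _)).
  apply: (recursive_seq_comp2 recursive2_add recursive2_sub).
  exact: recursive2_swap recursive2_sub.
move=> x y; rewrite /enc /=; have [->|xy] := eqVneq x y; first by rewrite !subnn.
by apply/esym/eqP; rewrite subn_eq0; lia.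
Qed.

Lemma computable_leq (a b : X -> nat) :
  computable a -> computable b -> computable (fun z => a z <= b z).
Proof.
move=> ca cb; apply: (computable_op2 (F := fun x y => 1 - (x - y))) => //.
  exact: (recursive_seq_comp2 recursive2_sub (recursive_seq_const _ _) recursive2_sub).
move=> x y; rewrite /enc /=; case: leqP => [|lt]; first by move/eqP->.
by apply/esym/eqP; rewrite subn_eq0 subn_gt0.
Qed.

Lemma computable_and (a b : X -> bool) :
  computable a -> computable b -> computable (fun z => a z && b z).
Proof. by move=> ca cb; apply: computable_if => //; apply: computable_const. Qed.

Lemma computable_or (a b : X -> bool) :
  computable a -> computable b -> computable (fun z => a z || b z).
Proof. by move=> ca cb; apply: computable_if => //; apply: computable_const. Qed.

Lemma computable_cons T {cT : coded T} (a : X -> T) (s : X -> seq T) :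
  computable a -> computable s -> computable (fun z => a z :: s z).
Proof. by apply: (computable_op2 recursive2_cpair). Qed.

Lemma computable_behead T {cT : coded T} (s : X -> seq T) :
  computable s -> computable (fun z => behead (s z)).
Proof.
apply: (computable_op1 recursive1_ctail); case=> [|x t]; first by [].
exact: esym (ctailE _ _).
Qed.

Lemma computable_case T U {cT : coded T} {cU : coded U} (s : X -> seq T)
    (a : X -> U) (f : X -> T -> seq T -> U) :
    computable s -> computable a ->
    computable (fun p : X * (T * seq T) => f p.1 p.2.1 p.2.2) ->
  computable (fun z => if s z is x :: t then f z x t else a z).
Proof.
case=> S rS SE [A rA AE] [F rF FE].
(* The code of [x :: t] is positive and is also the code of the pair [(x, t)], so [F] can take it as
   it stands. The test for zero is made arithmetic afterwards. *)
exists (fun c => if S c is 0 then A c else F (cpair c (S c))) => [|z]; last first.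
  rewrite -SE; case: (s z) => [|x t]; first exact: AE.
  rewrite (FE (z, (x, t))) !enc_pair enc_cons.
  by have /prednK <- : 0 < cpair (enc x) (enc t) by apply: leq_ltn_trans (ltn_cpair _ _).
apply: recursive_seq_ext (_ : recursive_seq 1 (fun s => (1 - S (nth 0 s 0)) * A (nth 0 s 0)
    + (1 - (1 - S (nth 0 s 0))) * F (cpair (nth 0 s 0) (S (nth 0 s 0))))) _; last first.
  by move=> c _; case: (S _) => [|n]; rewrite ?subn0 ?subSS ?sub0n ?mul1n ?mul0n ?addn0.
apply: (recursive_seq_comp2 recursive2_add); apply: (recursive_seq_comp2 recursive2_mul).
- exact: (recursive_seq_comp2 recursive2_sub (recursive_seq_const _ _)).
- by [].
- apply: (recursive_seq_comp2 recursive2_sub (recursive_seq_const _ _)).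
  exact: (recursive_seq_comp2 recursive2_sub (recursive_seq_const _ _)).
apply: (recursive_seq_comp1 rF).
exact: (recursive_seq_comp2 recursive2_cpair (recursive_seq_nth _ _)).
Qed.

End Computable.

(** Hooks of the tactic below, redefined with [::=] whenever further operations have been proved
    computable. *)
Ltac computability_code := fail.
Ltac computability_extra := fail.
Ltac computability_step := lazymatch goal with
  | |- computable (fun _ => ?u) => exact: computable_const
  | |- computable (fun z => z) => exact: computable_id
  | |- computable fst => exact: (computable_fst computable_id)
  | |- computable snd => exact: (computable_snd computable_id)
  | |- computable (fun z => (@?a z).1) => apply: computable_fst
  | |- computable (fun z => (@?a z).2) => apply: computable_snd
  | |- computable (fun z => (@?a z, @?b z)) => apply: computable_pair
  | |- computable (fun z => (@?a z) && (@?b z)) => apply: computable_and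
  | |- computable (fun z => (@?a z) || (@?b z)) => apply: computable_or
  | |- computable (fun z => @?a z == @?b z) => first [apply: computable_eqn | computability_extra]
  | |- computable (fun z => leq (S (@?a z)) (@?b z)) =>
      apply: computable_leq; [apply: computable_succ | ]
  | |- computable (fun z => leq (@?a z) (@?b z)) => apply: computable_leq
  | |- computable (fun z => S (@?a z)) => apply: computable_succ
  | |- computable (fun z => (@?a z) + (@?b z)) => apply: computable_addn
  | |- computable (fun z => (@?a z) * (@?b z)) => apply: computable_muln
  | |- computable (fun z => (@?a z) :: (@?b z)) => apply: computable_cons
  | |- computable (fun z => behead (@?a z)) => apply: computable_behead
  | _ => computability_extra
  end.
Ltac computability := repeat (cbv beta; computability_step).

Section ComputableSeq.
Context {X : Type} {cX : coded X}.

Lemma size_le_enc T {cT : coded T} (s : seq T) : size s <= enc s.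
Proof. by elim: s => // x s IHs; apply: leq_ltn_trans IHs (ltn_cpair _ _). Qed.

Lemma computable_foldl T A {cT : coded T} {cA : coded A} (f : X -> T -> A -> T)
    (a : X -> T) (s : X -> seq A) :
    computable (fun p : X * T * A => f p.1.1 p.1.2 p.2) ->
    computable a -> computable s ->
  computable (fun z => foldl (f z) (a z) (s z)).
Proof.
move=> cf ca cs.
(* The step is iterated as many times as the code of the list, which bounds its length; the surplus
   iterations find an empty list and change nothing. *)
pose step z (p : T * seq A) := if p.2 is x :: t then (f z p.1 x, t) else p.
have c := computable_iter (f := step) (computable_enc cs) (computable_pair ca cs) _.
apply: computable_ext (computable_fst (c _)) _ => [|z].
  apply: computable_case; computability.
  apply: (computable_comp (f := fun p : X * T * A => f p.1.1 p.1.2 p.2)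
    (g := fun q : X * (T * seq A) * (A * seq A) => (q.1.1, q.1.2.1, q.2.1)) cf).
  by computability.
elim: (s z) (a z) (enc (s z)) (@size_le_enc _ cA (s z)) => [|x t IHt] b n /=.
  by move=> _; have -> : iter n (step z) (b, [::]) = (b, [::]); first elim: n => //= n ->.
by case: n => // n lt_tn; rewrite iterSr IHt.
Qed.

Lemma computable_rev A {cA : coded A} (s : X -> seq A) :
  computable s -> computable (fun z => rev (s z)).
Proof.
move=> cs; apply: computable_ext (computable_foldl (f := fun _ t x => x :: t) _
  (computable_const [::]) cs) _ => [|z]; first by computability.
by rewrite -[RHS]cats0; elim: (s z) [::] => //= x t IHt u; rewrite IHt rev_cons cat_rcons.
Qed.

Lemma computable_foldr T A {cT : coded T} {cA : coded A} (f : X -> A -> T -> T)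
    (a : X -> T) (s : X -> seq A) :
    computable (fun p : X * A * T => f p.1.1 p.1.2 p.2) ->
    computable a -> computable s ->
  computable (fun z => foldr (f z) (a z) (s z)).
Proof.
move=> cf ca cs.
apply: computable_ext (computable_foldl (f := fun z t x => f z x t) _ ca (computable_rev cs)) _.
  apply: (computable_comp (f := fun p : X * A * T => f p.1.1 p.1.2 p.2)
    (g := fun q : X * T * A => (q.1.1, q.2, q.1.2)) cf).
  by computability.
by move=> z; rewrite foldl_rev.
Qed.

Lemma computable_map A B {cA : coded A} {cB : coded B} (f : X -> A -> B) (s : X -> seq A) :
    computable (fun p : X * A => f p.1 p.2) -> computable s ->
  computable (fun z => [seq f z x | x <- s z]).
Proof.
move=> cf cs; apply: computable_ext (computable_foldr (f := fun z x t => f z x :: t) _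
  (computable_const [::]) cs) _ => //.
by apply: computable_cons; computability;
  apply: (computable_comp (f := fun p : X * A => f p.1 p.2)
    (g := fun q : X * A * seq B => q.1) cf); computability.
Qed.

Lemma computable_all A {cA : coded A} (p : X -> A -> bool) (s : X -> seq A) :
    computable (fun q : X * A => p q.1 q.2) -> computable s ->
  computable (fun z => all (p z) (s z)).
Proof.
move=> cf cs; apply: computable_ext (computable_foldr (f := fun z x t => p z x && t) _
  (computable_const true) cs) _ => //.
by apply: computable_and; computability;
  apply: (computable_comp (f := fun q : X * A => p q.1 q.2)
    (g := fun q : X * A * bool => q.1) cf); computability.
Qed.

Lemma computable_cat A {cA : coded A} (s t : X -> seq A) :
  computable s -> computable t -> computable (fun z => s z ++ t z).
Proof.
move=> cs ct.
apply: computable_ext (computable_foldr (f := fun _ x t => x :: t) _ ct cs) _ => [|z].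
  by computability.
by elim: (s z) => //= x u ->.
Qed.

End ComputableSeq.

Section ComputableSeq2.
Context {X : Type} {cX : coded X}.

Lemma computable_flatten A {cA : coded A} (s : X -> seq (seq A)) :
  computable s -> computable (fun z => flatten (s z)).
Proof.
move=> cs; apply: computable_ext (computable_foldr (f := fun _ (x : seq A) t => x ++ t) _
  (computable_const [::]) cs) _ => //.
by apply: computable_cat; computability.
Qed.

Lemma computable_iota0 (n : X -> nat) :
  computable n -> computable (fun z => iota 0 (n z)).
Proof.
move=> cn; apply: computable_ext (computable_rec (f := fun _ k s => s ++ [:: k]) cn
  (computable_const [::]) _) _ => [|z].
  by cbv beta; apply: computable_cat; computability.
by elim: (n z) => // k IHk; rewrite -[k.+1]addn1 iotaD -IHk addn1.
Qed.

Lemma computable_size A {cA : coded A} (s : X -> seq A) :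
  computable s -> computable (fun z => size (s z)).
Proof.
move=> cs; apply: computable_ext (computable_foldr (f := fun _ x n => n.+1) _
  (computable_const 0) cs) _ => //.
by computability.
Qed.

Lemma computable_nth A {cA : coded A} (x0 : A) (s : X -> seq A) (i : X -> nat) :
  computable s -> computable i -> computable (fun z => nth x0 (s z) (i z)).
Proof.
move=> cs ci; apply: (computable_ext (f := fun z =>
  if iter (i z) behead (s z) is x :: t then x else x0)).
  apply: (computable_case (f := fun _ x _ => x)); computability.
  by apply: (computable_iter (f := fun _ => behead)); computability.
by move=> z; elim: (i z) (s z) => [|j IHj] [|x t] //; rewrite iterSr IHj ?nth_nil.
Qed.

End ComputableSeq2.

Lemma computable_dec_nat : computable (dec : nat -> nat).
Proof. exact: computable_id. Qed.

Lemma computable_dec_pair T U {cT : coded T} {cU : coded U} :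
  computable (dec : nat -> T) -> computable (dec : nat -> U) ->
  computable (dec : nat -> T * U).
Proof.
move=> c1 c2; apply: computable_pair.
  apply: (computable_comp c1); apply: (computable_op1 (f := chead) recursive1_chead) => //.
  exact: computable_id.
apply: (computable_comp c2); apply: (computable_op1 (f := ctail) recursive1_ctail) => //.
exact: computable_id.
Qed.

Lemma computable_dec_seq T {cT : coded T} :
  computable (dec : nat -> T) -> computable (dec : nat -> seq T).
Proof.
move=> c; apply: (computable_map (f := fun _ => dec)).
  by apply: (computable_comp c); computability.
exists id => [|n]; first exact: recursive_seq_nth.
by rewrite /enc /= map_id CodeSeq.decodeK.
Qed.

Import Pdiv.CommonRing.
Import Order.TTheory GRing.Theory Num.Theory.
Local Open Scope ring_scope.

(** * Noetherianity and the Nullstellensatz *)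

Lemma choice_fun (A B : Type) (P : A -> B -> Prop) :
  (forall x, exists y, P x y) -> exists f : A -> B, forall x, P x (f x).
Proof.
move=> ex; exists (fun x => proj1_sig (constructive_indefinite_description _ (ex x))) => x.
exact: proj2_sig (constructive_indefinite_description _ (ex x)).
Qed.

Lemma wf_minimal (T A : Type) (lt : T -> T -> Prop) (m : A -> T) (P : A -> Prop) :
    well_founded lt -> (exists x, P x) ->
  exists2 x, P x & forall y, P y -> ~ lt (m y) (m x).
Proof.
move=> wf [x Px]; move: {2}(m x) (erefl (m x)) => t.
elim/(well_founded_ind wf): t x Px => t IH x Px mx.
case: (classic (exists2 y, P y & lt (m y) t)) => [[y Py lty]|no].
  exact: (IH _ lty y).
by exists x => // y Py; rewrite mx => lty; apply: no; exists y.
Qed.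

Lemma ltn_wf : well_founded (fun m n : nat => (m < n)%N).
Proof.
move=> n; elim/ltn_ind: n => n IH; constructor => m; exact: IH.
Qed.

(** Each index is chosen beyond the previous one so as to minimize [u] over all indices from there
    on. *)
Lemma homo_subseq (u : nat -> nat) :
  exists2 phi : nat -> nat, {homo phi : i j / (i < j)%N} &
    {homo u \o phi : i j / (i < j)%N >-> (i <= j)%N}.
Proof.
have /choice_fun[m mP] : forall N, exists i, (N <= i)%N /\ forall j, (N <= j)%N -> (u i <= u j)%N.
  move=> N; have [|i Ni imin] := @wf_minimal _ _ _ u (fun i => N <= i)%N ltn_wf.
    by exists N.
  by exists i; split=> // j /imin/negP; rewrite -leqNgt.
pose phi := fix phi k := if k is k'.+1 then m (phi k').+1 else m 0%N.
have phiS k : (phi k < phi k.+1)%N by have [] := mP (phi k).+1.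
have phi_homo : {homo phi : i j / (i < j)%N} by apply: homo_ltn => //; apply: ltn_trans.
exists phi => // i j lt_ij /=.
have lt_phi := phi_homo _ _ lt_ij.
by case: i lt_phi {lt_ij} => [|i] /= lt_phi; [have [_]:= mP 0%N; apply | 
  have [le] := mP (phi i).+1; apply; apply: leq_trans le (ltnW lt_phi)].
Qed.

(** Subsequences are extracted one coordinate at a time; monotonicity in the earlier coordinates
    survives each extraction. *)
Lemma dickson n (u : nat -> 'X_{1..n}) :
  exists i j, (i < j)%N /\ (u i <= u j)%MM.
Proof.
suff /(_ n (leqnn n)) [phi phi_homo phi_le] : forall m, (m <= n)%N ->
    exists2 phi : nat -> nat, {homo phi : i j / (i < j)%N} &
      forall l : 'I_n, (l < m)%N -> forall i j, (i < j)%N -> (u (phi i) l <= u (phi j) l)%N.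
  exists (phi 0%N), (phi 1%N); split; first exact: phi_homo.
  by apply/mnm_lepP => l; apply: phi_le.
elim=> [_|m IHm lt_mn]; first by exists id.
have [phi phi_homo phi_le] := IHm (ltnW lt_mn).
have [psi psi_homo psi_le] := homo_subseq (fun i => u (phi i) (Ordinal lt_mn)).
exists (phi \o psi) => [i j /psi_homo/phi_homo //|l].
rewrite ltnS leq_eqVlt => /orP[/eqP lm|lt_lm] i j lt_ij.
  by have -> : l = Ordinal lt_mn by [apply: val_inj]; apply: psi_le.
by apply: phi_le => //; apply: psi_homo.
Qed.

(** * Ideals and the ascending chain condition *)

Definition ideal (R : comNzRingType) (I : R -> Prop) : Prop :=
  [/\ I 0, forall p q, I p -> I q -> I (p + q) & forall a p, I p -> I (a * p)].

Section Ideal.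
Context (R : comNzRingType) (I : R -> Prop) (idI : ideal I).

Lemma ideal0 : I 0. Proof. by case: idI. Qed.
Lemma idealD p q : I p -> I q -> I (p + q). Proof. by case: idI => _ + _; apply. Qed.
Lemma idealMl a p : I p -> I (a * p). Proof. by case: idI => _ _; apply. Qed.
Lemma idealMr a p : I p -> I (p * a). Proof. by rewrite mulrC; apply: idealMl. Qed.
Lemma idealN p : I p -> I (- p). Proof. by rewrite -mulN1r; apply: idealMl. Qed.
Lemma idealB p q : I p -> I q -> I (p - q).
Proof. by move=> Ip /idealN; apply: idealD. Qed.
Lemma idealBr p q : I (p - q) -> I q -> I p.
Proof. by move=> Ipq Iq; rewrite -[p](subrK q); apply: idealD. Qed.
Lemma ideal_sum (T : Type) (s : seq T) (P : pred T) (F : T -> R) :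
  (forall i, P i -> I (F i)) -> I (\sum_(i <- s | P i) F i).
Proof.
move=> IF; elim/big_rec: _ => [|i x Pi Ix]; first exact: ideal0.
by apply: idealD => //; apply: IF.
Qed.

Lemma ideal_colon p : ideal (fun s => I (s * p)).
Proof.
split; first by rewrite mul0r; apply: ideal0.
- by move=> a b Ia Ib; rewrite mulrDl; apply: idealD.
- by move=> a b Ib; rewrite -mulrA; apply: idealMl.
Qed.

Lemma ideal_adjoin x : ideal (fun p => exists s, I (p - s * x)).
Proof.
split; first by exists 0; rewrite mul0r subr0; apply: ideal0.
- move=> p q [s Is] [t It]; exists (s + t); rewrite mulrDl opprD addrACA.
  exact: idealD.
- by move=> a p [s Is]; exists (a * s); rewrite -mulrA -mulrBr; apply: idealMl.
Qed.

End Ideal.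

Definition prime_ideal (R : comNzRingType) (I : R -> Prop) : Prop :=
  [/\ ideal I, ~ I 1 & forall a b, I (a * b) -> I a \/ I b].

Section Noetherian.
Context (n : nat) (k : fieldType).
Implicit Types (I : {mpoly k[n]} -> Prop).

(** One step of the division algorithm. A zero difference has to be set apart, because [mlead 0] is
    the least monomial and need not be strictly below [mlead p]. *)
Lemma mlead_cancel (p q : {mpoly k[n]}) : p != 0 -> q != 0 -> (mlead q <= mlead p)%MM ->
  exists c, p - c * q != 0 -> (mlead (p - c * q) < mlead p)%O.
Proof.
move=> p0 q0 le_qp; pose a := p@_(mlead p) / q@_(mlead q).
have a0 : a != 0 by rewrite mulf_neq0 ?invr_eq0 ?mleadc_eq0.
exists (a *: 'X_[(mlead p - mlead q)%MM]) => d0.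
set c := _ *: _ in d0 *.
have c0 : c != 0 by rewrite -mleadc_eq0 /c mleadcZE mulf_neq0 // mleadXm mcoeffX eqxx oner_eq0.
have lcq : mlead (c * q) = mlead p.
  by rewrite mleadM // /c mleadZ // mleadXm submK.
rewrite lt_neqAle; apply/andP; split; last first.
  by apply: le_trans (mleadB_le _ _) _; rewrite lcq joinxx.
apply: contra_neq d0 => lead_eq; apply/eqP; rewrite -mleadc_eq0 lead_eq mcoeffB.
rewrite -{2}lcq mleadM // mleadcM /c mleadcZE mleadXm.
by rewrite mcoeffX eqxx mulr1 /a divfK ?subrr ?mleadc_eq0.
Qed.

(* Dickson's lemma is applied to elements of [J i.+1] outside [J i] with minimal
   leading monomial. *)
Lemma noetherian_chain (J : nat -> {mpoly k[n]} -> Prop) :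
    (forall i, ideal (J i)) -> (forall i p, J i p -> J i.+1 p) ->
  exists i, forall p, J i.+1 p -> J i p.
Proof.
move=> idJ incl; apply: NNPP => no.
have /choice_fun[f fP] : forall i, exists p, (J i.+1 p /\ ~ J i p) /\
    forall q, J i.+1 q /\ ~ J i q -> ~ (mlead q < mlead p)%O.
  move=> i; have [|p Pp pmin] := @wf_minimal _ _ _ (@mlead n k)
      (fun p => J i.+1 p /\ ~ J i p) (@ltom_wf n); last by exists p.
  apply: NNPP => none; apply: no; exists i => p Jp; apply: NNPP => nJp.
  by apply: none; exists p.
have f0 i : f i != 0.
  by apply/eqP => fi0; have [[_]] := fP i; rewrite fi0; case; apply: ideal0.
have [i [j [lt_ij le_ij]]] := dickson (fun i => mlead (f i)).
have [c cP] := mlead_cancel (f0 j) (f0 i) le_ij.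
have homoJ a b p : (a <= b)%N -> J a p -> J b p.
  by move/subnK <-; elim: (b - a)%N => //= d IHd /IHd; rewrite addSn; apply: incl.
have [[Jfi _] _] := fP i; have [[Jfj nJfj] min] := fP j.
have Jc : J j (c * f i) by apply: idealMl => //; apply: homoJ Jfi.
have Jnew : ~ J j (f j - c * f i) by move=> /(idealBr (idJ j))/(_ Jc).
apply: (min (f j - c * f i)).
  by split=> //; apply: (idealB (idJ j.+1)) => //; apply: incl.
by apply: cP; apply/eqP => e; apply: Jnew; rewrite e; apply: ideal0.
Qed.

(** Without a maximal element, choosing a strict enlargement of each ideal and iterating from [J0]
    would contradict [noetherian_chain]. *)
Lemma exists_maximal_ideal (Phi : ({mpoly k[n]} -> Prop) -> Prop) J0 :
    ideal J0 -> Phi J0 ->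
  exists2 J, ideal J /\ Phi J &
    forall J', ideal J' -> Phi J' -> (forall p, J p -> J' p) -> forall p, J' p -> J p.
Proof.
move=> id0 Phi0; apply: NNPP => no.
pose good := {J | ideal J /\ Phi J}.
have /choice_fun[next nextP] : forall J : good, exists J' : good,
    (forall p, sval J p -> sval J' p) /\ exists2 p, sval J' p & ~ sval J p.
  case=> J [idJ PhiJ]; apply: NNPP => none; apply: no; exists J => // J' id' Phi' sub p J'p.
  apply: NNPP => nJp; apply: none.
  by exists (exist _ J' (conj id' Phi')); split => //; exists p.
pose J i := iter i next (exist _ J0 (conj id0 Phi0)).
have [i|i p|i iP] := @noetherian_chain (fun i => sval (J i)).
- by case: (J i) => ? [].
- by have [+ _] := nextP (J i); apply.
by have [_ [p /iP]] := nextP (J i).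
Qed.

End Noetherian.

(** * The Nullstellensatz, by adjoining one variable at a time *)

Section Nullstellensatz.
Context (k : closedFieldType).

(** Density of the k-points in every irreducible closed subset. The element [q] makes the induction
    on variables work: it carries the leading coefficients that must not vanish at the point to be
    lifted. *)
Definition has_points (A : comNzRingType) (iota : k -> A) : Prop :=
  forall (P : A -> Prop) (q : A), prime_ideal P -> ~ P q ->
  exists phi : {rmorphism A -> k},
    [/\ forall c, phi (iota c) = c, forall p, P p -> phi p = 0 & phi q != 0].

Lemma prime_ideal_exp (A : comNzRingType) (P : A -> Prop) a m :
  prime_ideal P -> P (a ^+ m) -> P a.
Proof.
case=> idP n1 pr; elim: m => [|m IHm]; first by rewrite expr0 => /n1.
by rewrite exprS => /pr[|/IHm].
Qed.

Section PolyStep.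
Context (A : comNzRingType) (P : {poly A} -> Prop) (prP : prime_ideal P).
Let idP : ideal P. Proof. by case: prP. Qed.
Let P0 (a : A) := P a%:P.
(** Membership in the ideal of [{poly A}] generated by the constants in [P]. *)
Let low (p : {poly A}) := forall i, P0 p`_i.

Lemma prime_ideal_const : prime_ideal P0.
Proof.
case: prP => _ n1 pr; split=> // [|a b]; last by rewrite /P0 polyCM; apply: pr.
split; first by rewrite /P0 polyC0; apply: ideal0.
  by move=> a b; rewrite /P0 polyCD; apply: idealD.
by move=> a b; rewrite /P0 polyCM; apply: idealMl.
Qed.

Let primeM a b : ~ P a -> ~ P b -> ~ P (a * b).
Proof. by move=> na nb; case: prP => _ _ /[apply] -[]. Qed.

Let primeX a m : ~ P a -> ~ P (a ^+ m).
Proof. by move=> na /(prime_ideal_exp prP). Qed.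

(** If the leading coefficient of a shortest element of [U] were in [P0], dropping the leading term
    would give a shorter element of [U]. *)
Let minimal_lead (U : {poly A} -> Prop) : (forall u v, U u -> P (u - v) -> low (u - v) -> U v) ->
    ~ U 0 -> (exists u, U u) ->
  exists2 u, U u /\ ~ P0 (lead_coef u) & forall v, U v -> (size u <= size v)%N.
Proof.
move=> Ustab U0 exU.
have [u Uu umin] := @wf_minimal _ _ _ (fun u : {poly A} => size u) U ltn_wf exU.
exists u => [|v Uv]; last by rewrite leqNgt; apply/negP/umin.
split=> // Plead.
have u0 : u != 0 by apply: contra_notN U0 => /eqP <-.
pose v := u - lead_coef u *: 'X^((size u).-1).
apply: (umin v); last first.
  rewrite [ltnRHS]polySpred // ltnS; apply/leq_sizeP => j.
  rewrite leq_eqVlt coefB coefZ coefXn => /orP[/eqP <-|ltj].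
    by rewrite eqxx mulr1 lead_coefE subrr.
  rewrite gtn_eqF // mulr0 subr0 nth_default //.
  by rewrite polySpred.
have vE : u - v = (lead_coef u)%:P * 'X^((size u).-1) by rewrite subKr mul_polyC.
apply: (Ustab u) => //; rewrite vE; first exact: (idealMr idP).
by move=> i; rewrite coefCM coefXn /P0 polyCM; apply: idealMr.
Qed.

(* With [f] minimal in P and [u] minimal in P + (q), modulo the constants in P, a
   point of the constants where neither leading coefficient vanishes lifts to
   every root of [f]; minimality forces [u] to be a constant. *)
Lemma prime_ideal_poly_points (q : {poly A}) : ~ P q ->
  exists2 w, ~ P0 w & forall phi : {rmorphism A -> k}, phi w != 0 ->
    (forall a, P0 a -> phi a = 0) ->
  exists t, (forall p, P p -> (map_poly phi p).[t] = 0) /\ (map_poly phi q).[t] != 0.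
Proof.
move=> nPq; have [P0id P01 P0pr] := prime_ideal_const.
have map_low (phi : {rmorphism A -> k}) p : (forall a, P0 a -> phi a = 0) -> low p -> map_poly phi p = 0.
  by move=> phi0 lowp; apply/polyP => i; rewrite coef_map coef0 /= phi0.
have lowP p : low p -> P p.
  move=> lowp; rewrite -[p]coefK poly_def; apply: ideal_sum => // i _.
  by rewrite -mul_polyC; apply: idealMr idP _ _ (lowp i).
(* If [P] is generated by constants, the fibre is a whole line, and it is enough to keep one
   coefficient of [q] nonzero. *)
have [all_low|] := classic (forall p, P p -> low p).
  have [i nPi] : exists i, ~ P0 q`_i.
    by apply: NNPP => no; apply: nPq; apply: lowP => i; apply: NNPP => ?; apply: no; exists i.
  exists q`_i => // phi phi_i phi0.
  have /closed_nonrootP[t qt] : map_poly phi q != 0.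
    by apply: contra_neq phi_i => q0; rewrite -coef_map q0 coef0.
  by exists t; split=> // p /all_low lowp; rewrite (map_low phi) ?horner0.
move=> nall.
have [|||f [[Pf nlowf] nPl] fmin] := @minimal_lead (fun f => P f /\ ~ low f).
- move=> u v [Pu nlowu] Puv lowuv; split.
    by rewrite -[v](subKr u); apply: idealB.
  move=> lowv; apply: nlowu => i; rewrite -[u](subrK v) coefD /P0 polyCD.
  by apply: idealD => //; [apply: lowuv | apply: lowv].
- by case=> _ []; move=> i; rewrite coef0; apply: (ideal0 P0id).
- by apply: NNPP => no; apply: nall => p Pp; apply: NNPP => nl; apply: no; exists p.
have f0 : f != 0.
  by apply/eqP => f0; apply: nlowf; rewrite f0 => i; rewrite coef0; apply: (ideal0 P0id).
set l := lead_coef f in nPl.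
(* The remainder of a pseudo-division by [f] lies in [P] and is shorter than [f], so it is [low] by
   the minimality of [f]. *)
have divf p : P p -> exists s u r, l ^+ s *: p = u * f + r /\ low r.
  move=> Pp; exists (rscalp p f), (rdivp p f), (rmodp p f).
  have divE := Pdiv.ComRing.rdivp_eq f p; split => //.
  apply: NNPP => nlow; suff: (size f <= size (rmodp p f))%N by rewrite leqNgt ltn_rmodp f0.
  apply: fmin; split=> //.
  have -> : rmodp p f = l ^+ rscalp p f *: p - rdivp p f * f by rewrite divE addrAC subrr add0r.
  by apply: idealB => //; [rewrite -mul_polyC|]; apply: idealMl.
have [|||u [[nPu [a Pua]] nPc] umin] := @minimal_lead (fun u => ~ P u /\ exists a, P (u - a * q)).
- move=> u v [nPu [a Pua]] Puv _; split.
    by move=> Pv; apply: nPu; apply: idealBr Puv Pv.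
  exists a; rewrite -[v](subKr u) addrAC; exact: idealB.
- by case=> + _; case; apply: ideal0.
- by exists q; split=> //; exists 1; rewrite mul1r subrr; apply: ideal0.
set c := lead_coef u in nPc.
have u0 : u != 0 by apply/eqP => u0; apply: nPu; rewrite u0; apply: ideal0.
(* As [l] is not in [P0], the pseudo-remainder of [u] by [f] is still in P + (q) and outside [P], so
   it is no shorter than [u]. *)
have lt_uf : (size u < size f)%N.
  apply: leq_ltn_trans (_ : size (rmodp u f) < size f)%N; last by rewrite ltn_rmodp.
  have divE := Pdiv.ComRing.rdivp_eq f u.
  have rE : rmodp u f = l ^+ rscalp u f *: u - rdivp u f * f by rewrite divE addrAC subrr add0r.
  apply: umin; split.
    rewrite rE => /(idealBr idP)/(_ (idealMl idP _ Pf)).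
    by rewrite -mul_polyC; apply: primeM => //; rewrite polyC_exp; apply: primeX.
  exists (l ^+ rscalp u f *: a); rewrite rE -scalerAl addrAC -scalerBr.
  by apply: idealB => //; [rewrite -mul_polyC|]; apply: idealMl.
exists (l * c) => [/P0pr[]//|phi]; rewrite rmorphM mulf_eq0 negb_or => /andP[phil phic] phi0.
pose F := map_poly phi f; pose U := map_poly phi u.
have sizeF : size F = size f by rewrite size_map_poly_id0.
have sizeU : size U = size u by rewrite size_map_poly_id0.
have F0 : F != 0 by rewrite -size_poly_eq0 sizeF size_poly_eq0.
have dvdF p : P p -> exists G s, phi l ^+ s *: map_poly phi p = G * F.
  case/divf => s [v [r [divE lowr]]]; exists (map_poly phi v), s.
  by rewrite -rmorphXn -map_polyZ divE rmorphD rmorphM /= (map_low phi r) ?addr0.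
(* Otherwise divide [f] by [u], with quotient [v] and remainder [r]. Minimality of [u] puts [r] in
   [P], minimality of [f] makes it [low], and primality puts [v] in [P]. After applying [phi], up to
   nonzero constants, [F] is the image of [v] times [U] and also divides the image of [v]: this
   makes [U] constant. *)
have size_u : size u = 1%N.
  apply/eqP; apply: contraT => u1.
  have gt_u : (1 < size u)%N by rewrite ltn_neqAle eq_sym u1 size_poly_gt0.
  have divE := Pdiv.ComRing.rdivp_eq u f.
  set s := rscalp f u in divE; set v := rdivp f u in divE; set r := rmodp f u in divE.
  have lt_r : (size r < size u)%N by rewrite ltn_rmodp.
  have rE : r = c ^+ s *: f - v * u by rewrite divE addrAC subrr add0r.
  have Pr : P r.
    apply: NNPP => nPr; suff: (size u <= size r)%N by rewrite leqNgt lt_r.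
    apply: umin; split=> //; exists (- v * a).
    have -> : r - - v * a * q = c ^+ s *: f - v * (u - a * q).
      by rewrite rE mulrBr !mulNr mulrA opprB opprK addrA addrAC.
    by apply: idealB => //; [rewrite -mul_polyC|]; apply: idealMl.
  have lowr : low r.
    apply: NNPP => nlow; suff: (size f <= size r)%N.
      by rewrite leqNgt (ltn_trans lt_r).
    exact: fmin.
  have Pv : P v.
    apply: NNPP => nPv; apply: (primeM nPv nPu).
    have -> : v * u = c ^+ s *: f - r by rewrite divE addrK.
    by apply: idealB => //; rewrite -mul_polyC; apply: idealMl.
  have VU : phi c ^+ s *: F = map_poly phi v * U.
    by rewrite -rmorphXn -map_polyZ divE rmorphD rmorphM /= (map_low phi r) ?addr0.
  have [G [s' VG]] := dvdF v Pv.
  have V0 : map_poly phi v != 0.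
    apply: contra_neq F0 => V0; move/eqP: VU; rewrite V0 mul0r scaler_eq0.
    by rewrite expf_eq0 (negPf phic) andbF => /eqP.
  have U0 : U != 0 by rewrite -size_poly_eq0 sizeU size_poly_eq0.
  have G0 : G != 0.
    apply: contra_neq V0 => G0; move/eqP: VG; rewrite G0 mul0r scaler_eq0.
    by rewrite expf_eq0 (negPf phil) andbF => /eqP.
  have sV : (size F <= size (map_poly phi v))%N.
    have <- : size (phi l ^+ s' *: map_poly phi v) = size (map_poly phi v).
      by rewrite size_scale // expf_neq0.
    rewrite VG size_mul //.
    by rewrite -(prednK (_ : 0 < size G)%N) ?size_poly_gt0 // addSn leq_addl.
  have: (size (map_poly phi v * U)%R <= size F)%N.
    by rewrite -VU size_scale // expf_neq0.
  rewrite size_mul // sizeU => le_size; move: (leq_trans le_size sV).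
  by case: (size u) gt_u => [|[|m]] // _; rewrite !addnS /= ltnNge leq_addr.
have uE : u = c%:P by rewrite /c lead_coefE size_u; apply: size1_polyC; rewrite size_u.
have /closed_rootP[t /rootP Ft] : size F != 1%N.
  by move: lt_uf; rewrite size_u sizeF => lt1f; rewrite gtn_eqF.
have Pt p : P p -> (map_poly phi p).[t] = 0.
  case/dvdF => G [s GE]; have := congr1 (horner^~ t) GE.
  rewrite hornerM Ft mulr0 hornerZ => /eqP.
  by rewrite mulf_eq0 expf_eq0 (negPf phil) andbF => /eqP.
exists t; split=> //.
(* Modulo [P] the constant [c] is a multiple of [q], and [phi c] is nonzero, so [q] cannot vanish at
   [t]. *)
have := Pt _ Pua; rewrite rmorphB rmorphM /= hornerD hornerN hornerM uE map_polyC hornerC.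
by move/eqP; rewrite subr_eq0 => /eqP cE; apply: contra_neq phic => q0; rewrite cE q0 mulr0.
Qed.

End PolyStep.

Lemma has_points_poly (A : comNzRingType) (iota : k -> A) :
  has_points iota -> has_points (fun c => (iota c)%:P).
Proof.
move=> ptA P q prP nPq.
have [w nPw wP] := prime_ideal_poly_points prP nPq.
have [phi [phi_iota phi0 phiw]] := ptA _ w (prime_ideal_const prP) nPw.
have [t [Pt qt]] := wP phi phiw phi0.
exists (GRing.RMorphism.clone _ _ (horner_eval t \o map_poly phi) _).
by split=> [c|p /Pt|] //; rewrite /= /horner_eval map_polyC hornerC /= phi_iota.
Qed.

Lemma has_points_mpoly n : has_points (@mpolyC n k).
Proof.
elim: n => [|n IHn] P q [idP P1 prP] nPq.
  have cE (p : {mpoly k[0]}) : p = (p@_0)%:MP.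
    apply/mpolyP => m; have -> : m = 0%MM by apply/mnmP => -[].
    by rewrite mcoeffC eqxx mulr1.
  exists (GRing.RMorphism.clone _ _ (meval (fun _ : 'I_0 => 0)) _).
  split=> [c|p Pp|] /=; first by rewrite mevalC.
    rewrite [p]cE mevalC; apply/eqP; apply: contraT => p0; case: P1.
    have : P ((p@_0)^-1%:MP * (p@_0)%:MP) by rewrite -cE; apply: idealMl.
    by rewrite -mpolyCM mulVf.
  by rewrite [q]cE mevalC; apply: contra_notN nPq => /eqP q0; rewrite [q]cE q0 mpolyC0; apply: (ideal0 idP).
(* [psi] is a left inverse of [muni]: the prime ideal is pulled back along [psi], and the point
   obtained is carried back along [muni]. *)
pose psi (p : {poly {mpoly k[n]}}) := (map_poly (@mwiden n k) p).['X_ord_max].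
have psiD : {morph psi : x y / x + y} by move=> x y; rewrite /psi rmorphD hornerD.
have psiM : {morph psi : x y / x * y} by move=> x y; rewrite /psi rmorphM hornerM.
have psi1 : psi 1 = 1 by rewrite /psi rmorph1 hornerC.
have psi0 : psi 0 = 0 by rewrite /psi rmorph0 horner0.
have psiK p : psi (muni p) = p.
  rewrite muniE (big_morph psi psiD psi0) [RHS]mpolyE; apply: eq_bigr => m _.
  rewrite /psi map_polyZ hornerZ map_polyXn hornerXn /= mwidenZ mwidenX -scalerAl.
  congr (_ *: _); rewrite mpolyXn -mpolyXD; congr 'X_[_].
  apply/mnmP => i; rewrite mnmDE mulmnE mnm1E.
  have [j -> | ->] := unliftP ord_max i.
    have -> : lift ord_max j = widen_ord (leqnSn n) j by apply/val_inj; rewrite /= /bump leqNgt ltn_ord.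
    by rewrite mnmwiden_widen mnmE -val_eqE /= gtn_eqF ?ltn_ord // mul0n addn0.
  by rewrite mnmwiden_ordmax eqxx mul1n.
have [||phi [phi_c phi0 phiq]] := has_points_poly IHn (P := P \o psi) (q := muni q).
- split=> [|/=|a b /=]; rewrite ?psi1 // ?psiM; last exact: prP.
  split=> [|a b /=|a b /=]; first by rewrite /= psi0; apply: ideal0.
    by rewrite psiD; apply: idealD.
  by rewrite psiM; apply: idealMl.
- by rewrite /= psiK.
exists (GRing.RMorphism.clone _ _ (phi \o @muni n k) _).
by split=> [c|p Pp|] //=; [rewrite muniC phi_c | apply: phi0; rewrite /= psiK].
Qed.

Lemma rmorph_meval n (phi : {rmorphism {mpoly k[n]} -> k}) p :
  (forall c, phi c%:MP = c) -> phi p = p.@[fun i => phi 'X_i].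
Proof.
move=> phi_c; rewrite {1}[p]mpolyE rmorph_sum mevalE; apply: eq_bigr => m _ /=.
rewrite -mul_mpolyC rmorphM phi_c; congr (_ * _).
by rewrite mpolyXE_id rmorph_prod; apply: eq_bigr => i _; rewrite rmorphXn.
Qed.

Lemma prime_nullstellensatz n (P : {mpoly k[n]} -> Prop) q : prime_ideal P -> ~ P q ->
  exists a : 'I_n -> k, (forall p, P p -> p.@[a] = 0) /\ q.@[a] != 0.
Proof.
move=> prP /(has_points_mpoly prP)[phi [phi_c phi0 phiq]].
exists (fun i => phi 'X_i); split=> [p|]; last by rewrite -rmorph_meval.
by rewrite -rmorph_meval //; apply: phi0.
Qed.

Lemma mpoly_nonroot n (p : {mpoly k[n]}) : p != 0 -> exists a, p.@[a] != 0.
Proof.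
move=> /eqP p0; have [|a [_ pa]] := @prime_nullstellensatz n (eq^~ 0) p _ p0; last by exists a.
split=> [||a b /eqP]; last by rewrite mulf_eq0 => /orP[/eqP|/eqP]; auto.
  by split=> // [a b -> ->|a b ->]; rewrite ?addr0 ?mulr0.
by apply/eqP; rewrite oner_eq0.
Qed.

(** A maximal element among the proper ideals containing [I] is prime, and prime ideals have
    zeros. *)
Lemma nullstellensatz n (I : {mpoly k[n]} -> Prop) : ideal I -> ~ I 1 ->
  exists a : 'I_n -> k, forall p, I p -> p.@[a] = 0.
Proof.
move=> idI I1.
have [||J [idJ [subJ J1]] Jmax] := @exists_maximal_ideal n k
  (fun J => (forall p, I p -> J p) /\ ~ J 1) I => //.
have [|a [Ja _]] := @prime_nullstellensatz n J 1 _ J1; last by exists a => p /subJ /Ja.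
split=> // a b Jab; apply: NNPP => /Decidable.not_or[nJa nJb]; apply: nJa.
apply: (Jmax _ (ideal_adjoin idJ a)).
- split=> [p /subJ Jp|[s J1s]]; first by exists 0; rewrite mul0r subr0.
  apply: nJb; have -> : b = (1 - s * a) * b + s * (a * b) by ring.
  by apply: idealD => //; [apply: idealMr | apply: idealMl].
- by move=> p Jp; exists 0; rewrite mul0r subr0.
- by exists 1; rewrite mul1r subrr; apply: ideal0.
Qed.

End Nullstellensatz.

(** * Residual finiteness *)

Lemma mpoly_rmorph_ext n (k S : nzRingType) (phi psi : {rmorphism {mpoly k[n]} -> S}) :
  (forall c, phi c%:MP = psi c%:MP) -> (forall i, phi 'X_i = psi 'X_i) -> phi =1 psi.
Proof.
move=> eqC eqX p; rewrite [p]mpolyE !rmorph_sum; apply: eq_bigr => m _ /=.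
rewrite -!mul_mpolyC !rmorphM eqC; congr (_ * _).
by rewrite mpolyXE_id !rmorph_prod; apply: eq_bigr => i _; rewrite !rmorphXn eqX.
Qed.

(** * Evaluation of polynomials at commuting matrices *)

Section MatrixEvaluation.
Context (k : fieldType) (r n : nat).
Implicit Types (A : 'I_r -> 'M[k]_n.+1) (p q : {mpoly k[r]}).

(** For arbitrary [A] this is only linear, the factors of a monomial being taken in the order of
    their indices; commutation makes it multiplicative. *)
Definition mx_meval A p : 'M[k]_n.+1 := mmap (@scalar_mx k n.+1) A p.

Lemma mx_mevalC A c : mx_meval A c%:MP = c%:M.
Proof. exact: mmapC. Qed.

Lemma mx_mevalXU A i : mx_meval A 'X_i = A i.
Proof. by rewrite /mx_meval mmapX mmap1U. Qed.

Lemma mx_mevalD A : {morph mx_meval A : p q / p + q}.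
Proof. exact: mmapD. Qed.

Lemma mx_mevalZ A c p : mx_meval A (c *: p) = c *: mx_meval A p.
Proof. by rewrite /mx_meval mmapZ -mul_scalar_mx. Qed.

Lemma mx_meval_sum A (T : Type) (s : seq T) (P : pred T) (F : T -> {mpoly k[r]}) :
  mx_meval A (\sum_(i <- s | P i) F i) = \sum_(i <- s | P i) mx_meval A (F i).
Proof. exact: raddf_sum. Qed.

Lemma mx_mevalX A m : mx_meval A 'X_[m] = \prod_i A i ^+ m i.
Proof. exact: mmapX. Qed.

Lemma eq_mx_meval A B p : A =1 B -> mx_meval A p = mx_meval B p.
Proof. by move=> eqAB; apply: eq_bigr => m _; congr (_ * _); apply: mmap1_eq. Qed.

Section Commuting.
Context (A : 'I_r -> 'M[k]_n.+1) (commA : forall i j, GRing.comm (A i) (A j)).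

Lemma mx_mevalM : {morph mx_meval A : p q / p * q}.
Proof.
move=> p q; rewrite [p]mpolyE [q]mpolyE mulr_suml !mx_meval_sum mulr_suml.
apply: eq_bigr => m1 _; rewrite mulr_sumr !mx_meval_sum mulr_sumr; apply: eq_bigr => m2 _.
rewrite -scalerAl -scalerAr -mpolyXD !mx_mevalZ -scalerAl -scalerAr !mx_mevalX.
do 2 congr (_ *: _); elim: (index_enum _) => [|i s IHs].
  by rewrite !big_nil mulr1.
rewrite !big_cons IHs mnmDE exprD -!mulrA; congr (_ * _); rewrite !mulrA; congr (_ * _).
by apply: commr_prod => j _; apply/commrX/commr_sym/commrX.
Qed.

Lemma mx_mevalXn p m : mx_meval A (p ^+ m) = mx_meval A p ^+ m.
Proof.
elim: m => [|m IHm]; last by rewrite !exprS mx_mevalM IHm.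
by rewrite !expr0 -mpolyC1 mx_mevalC.
Qed.

Lemma mx_meval_comp (g : r.-tuple {mpoly k[r]}) p :
  mx_meval A (p \mPo g) = mx_meval (fun i => mx_meval A (tnth g i)) p.
Proof.
rewrite comp_mpolyEX mx_meval_sum [in RHS](mpolyE p) mx_meval_sum; apply: eq_bigr => m _.
rewrite !mx_mevalZ mx_mevalX comp_mpolyX; congr (_ *: _).
elim: (index_enum _) => [|i s IHs]; first by rewrite !big_nil -mpolyC1 mx_mevalC.
by rewrite !big_cons mx_mevalM IHs mx_mevalXn.
Qed.

End Commuting.
End MatrixEvaluation.

(** * Quotients of finite dimension as algebras of matrices *)

Section FiniteQuotient.
Context (k : closedFieldType) (r : nat) (J : {mpoly k[r]} -> Prop) (idJ : ideal J).

Definition spans_quotient n (b : 'I_n -> {mpoly k[r]}) : Prop :=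
  forall p, exists c : 'I_n -> k, J (p - \sum_i c i *: b i).

Lemma ideal_scale c p : J p -> J (c *: p).
Proof. by rewrite -mul_mpolyC; apply: idealMl. Qed.

(** A spanning family of least size is free: a relation with a nonzero coefficient would express one
    member through the others. *)
Lemma quotient_basis n (b : 'I_n -> {mpoly k[r]}) : spans_quotient b ->
  exists m (e : 'I_m -> {mpoly k[r]}), spans_quotient e /\
    forall c, J (\sum_i c i *: e i) -> forall i, c i = 0.
Proof.
move=> span_b.
have [|m [e span_e] min] := @wf_minimal _ _ _ id
  (fun m => exists e : 'I_m -> {mpoly k[r]}, spans_quotient e) ltn_wf.
  by exists n, b.
exists m, e; split=> // c Jc i; apply/eqP; apply: contraT => ci.
case: m e span_e min c Jc i ci => [|m] e span_e min c Jc i ci; first by case: i ci.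
case: (min m); last exact: ltnSn.
exists (fun j => e (lift i j)) => p; have [d Jd] := span_e p.
exists (fun j => d (lift i j) - d i / c i * c (lift i j)).
move: Jc Jd; rewrite !(bigD1_ord i) //= => Jc Jd.
set S := \sum_j _; have -> : p - S = (p - (d i *: e i + \sum_j d (lift i j) *: e (lift i j)))
   + (d i / c i) *: (c i *: e i + \sum_j c (lift i j) *: e (lift i j)).
  rewrite /S scalerDr scalerA divfK // scaler_sumr.
  rewrite -addrA; congr (_ + _); rewrite opprD addrACA addNr add0r.
  rewrite -!sumrN -big_split /=; apply: eq_bigr => j _.
  by rewrite scalerBl opprB scalerA addrC.
by apply: idealD => //; apply: ideal_scale.
Qed.

(* Multiplication by [q] on the quotient by [J], in the basis [e], gives a
   representation of the polynomial ring whose kernel is [J]. *)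
Lemma quotient_matrices n (b : 'I_n -> {mpoly k[r]}) : spans_quotient b -> ~ J 1 ->
  exists m (A : 'I_r -> 'M[k]_m.+1), (forall i j, GRing.comm (A i) (A j)) /\
    forall p, J p <-> mx_meval A p = 0.
Proof.
move=> /quotient_basis[m [e [span_e free_e]]] J1.
case: m => [|m] in e span_e free_e *.
  by case: J1; have [c] := span_e 1; rewrite big_ord0 subr0.
pose repr (q : {mpoly k[r]}) (M : 'M[k]_m.+1) := forall j, J (e j * q - \sum_l M j l *: e l).
have repr_uniq q M M' : repr q M -> repr q M' -> M = M'.
  move=> rM rM'; apply/matrixP => j l; apply/eqP; rewrite -subr_eq0; apply/eqP.
  apply: (free_e (fun l => M j l - M' j l)).
  have -> : \sum_i (M j i - M' j i) *: e i =
    (e j * q - \sum_l M' j l *: e l) - (e j * q - \sum_l M j l *: e l).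
    rewrite opprB addrC addrA subrK -sumrB; apply: eq_bigr => i _.
    by rewrite scalerBl.
  exact: idealB.
have /choice_fun[M MP] : forall q, exists M, repr q M.
  move=> q; have /choice_fun[c cP] := fun j => span_e (e j * q).
  by exists (\matrix_(j, l) c j l) => j; under eq_bigr do rewrite mxE.
have MD p q : M (p + q) = M p + M q.
  apply: repr_uniq (MP _) _ => j; under eq_bigr do rewrite mxE scalerDl.
  by rewrite big_split mulrDr opprD addrACA; apply: idealD => //; apply: MP.
have MZ c p : M (c *: p) = c *: M p.
  apply: repr_uniq (MP _) _ => j; under eq_bigr do rewrite mxE -scalerA.
  by rewrite -scaler_sumr -scalerAr -scalerBr; apply: ideal_scale; apply: MP.
have MM p q : M (p * q) = M p * M q.
  apply: repr_uniq (MP _) _ => j.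
  have -> : e j * (p * q) - \sum_l (M p * M q) j l *: e l =
     (e j * p - \sum_l M p j l *: e l) * q + \sum_l M p j l *: (e l * q - \sum_t M q l t *: e t).
    rewrite mulrBl mulr_suml mulrA -addrA; congr (_ + _).
    under [X in _ = _ + X]eq_bigr do rewrite scalerBr.
    rewrite sumrB addrA [X in _ = X - _]addrC.
    under [X in _ = X + _ - _]eq_bigr do rewrite scalerAl.
    rewrite subrr add0r; congr (- _).
    under [RHS]eq_bigr do rewrite scaler_sumr.
    rewrite exchange_big; apply: eq_bigr => t _ /=; rewrite mxE scaler_suml.
    by apply: eq_bigr => l _; rewrite scalerA.
  apply: idealD => //; first by apply: idealMr => //; apply: MP.
  by apply: ideal_sum => // l _; apply: ideal_scale; apply: MP.
have M1 : M 1 = 1.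
  apply: repr_uniq (MP _) _ => j; rewrite (bigD1 j) //= big1 => [|l lj].
    by rewrite mxE eqxx scale1r mulr1 addr0 subrr; apply: ideal0.
  by rewrite mxE eq_sym (negPf lj) scale0r.
have M0 : M 0 = 0 by rewrite -(scale0r 0) MZ scale0r.
exists m, (fun i => M 'X_i); split=> [i j|p]; first by rewrite /GRing.comm -!MM mulrC.
have -> : mx_meval (fun i => M 'X_i) p = M p.
  rewrite [p]mpolyE mx_meval_sum (big_morph M MD M0); apply: eq_bigr => u _.
  rewrite mx_mevalZ MZ mx_mevalX mpolyXE_id; congr (_ *: _).
  rewrite (big_morph M MM M1); apply: eq_bigr => i _.
  by elim: (u i) => [|s IHs]; rewrite ?expr0 // !exprS MM IHs.
split=> [Jp|Mp].
  apply: repr_uniq (MP _) _ => j; rewrite big1 ?subr0 => [|l _]; first exact: idealMl.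
  by rewrite mxE scale0r.
(* If multiplication by [p] is zero on the quotient, so is its value on 1, written in the basis
   since 1 need not belong to it. *)
have [c c1] := span_e 1; rewrite -[p]mul1r.
apply: (idealBr idJ (q := (\sum_i c i *: e i) * p)).
  by rewrite -mulrBl; apply: idealMr.
rewrite mulr_suml; apply: ideal_sum => // i _; rewrite -scalerAl; apply: ideal_scale.
have := MP p i; rewrite Mp big1 ?subr0 // => l _.
by rewrite mxE scale0r.
Qed.

(** In the shifted variables ['X_j - a j], a monomial of degree at least [K], which exceeds the sum
    of the [N j], has some exponent at least [N j] and so lies in [J]. The finitely many others
    span. *)
Lemma nilpotent_spans (a : 'I_r -> k) :
    (forall j, exists N, J (('X_j - (a j)%:MP) ^+ N)) ->
  exists n (b : 'I_n -> {mpoly k[r]}), spans_quotient b.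
Proof.
move=> /choice_fun[N NP]; pose K := (\sum_j N j).+1.
pose sigma := [tuple 'X_j + (a j)%:MP | j < r]; pose tau := [tuple 'X_j - (a j)%:MP | j < r].
have sigmaK p : (p \mPo sigma) \mPo tau = p.
  pose phi : {rmorphism {mpoly k[r]} -> {mpoly k[r]}} :=
    GRing.RMorphism.clone _ _ (comp_mpoly tau \o comp_mpoly sigma) _.
  apply: (@mpoly_rmorph_ext _ _ _ phi idfun) => [c|i] /=; first by rewrite !comp_mpolyC.
  rewrite comp_mpolyXU -tnth_nth tnth_mktuple comp_mpolyD comp_mpolyC comp_mpolyXU.
  by rewrite -tnth_nth tnth_mktuple subrK.
pose b0 (m : 'X_{1..r < K}) := 'X_[val m] \mPo tau.
exists #|{: 'X_{1..r < K}}|, (fun i => b0 (enum_val i)).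
pose spanned (p : {mpoly k[r]}) :=
  exists c : 'I_#|{: 'X_{1..r < K}}| -> k, J (p - \sum_i c i *: b0 (enum_val i)).
have spannedD p q : spanned p -> spanned q -> spanned (p + q).
  move=> [c Jc] [d Jd]; exists (fun i => c i + d i).
  under eq_bigr do rewrite scalerDl.
  by rewrite big_split opprD addrACA; apply: idealD.
have spannedZ c p : spanned p -> spanned (c *: p).
  move=> [d Jd]; exists (fun i => c * d i); under eq_bigr do rewrite -scalerA.
  by rewrite -scaler_sumr -scalerBr; apply: ideal_scale.
have spannedJ p : J p -> spanned p.
  by move=> Jp; exists (fun=> 0); rewrite big1 ?subr0 // => i _; rewrite scale0r.
have spannedX m : spanned ('X_[m] \mPo tau).
  case: (ltnP (mdeg m) K) => [ltm|le_m].
    exists (fun i => (i == enum_rank (BMultinom ltm))%:R).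
    rewrite (bigD1 (enum_rank (BMultinom ltm))) //= big1 => [|i /negPf ->].
      by rewrite eqxx scale1r addr0 /b0 enum_rankK subrr; apply: ideal0.
    by rewrite scale0r.
  apply: spannedJ; have [j lej] : exists j, (N j <= m j)%N.
    apply: NNPP => no; move: le_m; rewrite leqNgt mdegE ltnS => /negP; apply.
    by apply: leq_sum => j _; rewrite leqNgt; apply/negP => /ltnW lt; apply: no; exists j.
  rewrite comp_mpolyX (bigD1 j) //= tnth_mktuple -(subnK lej) exprD -mulrA.
  by apply: (idealMl idJ); apply: (idealMr idJ).
suff: forall p, spanned p by [].
move=> p; rewrite -(sigmaK p) comp_mpolyEX; elim/big_rec: _ => [|m q _].
  exact: spannedJ (ideal0 idJ).
by move=> sq; apply: (spannedD _ _ _ sq); apply: spannedZ.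
Qed.

End FiniteQuotient.

Section ResidualFiniteness.
Context (k : closedFieldType) (r : nat).
Implicit Types (p : {mpoly k[r]}).

(* An ideal that is maximal among those containing no ['X_i ^+ N * p] is primary
   to a point with nonzero [i]-th coordinate, hence has finite codimension. *)
Theorem residually_finite (I : {mpoly k[r]} -> Prop) (i : 'I_r) p :
    ideal I -> (forall N, ~ I ('X_i ^+ N * p)) ->
  exists n (A : 'I_r -> 'M[k]_n.+1),
    [/\ forall j l, GRing.comm (A j) (A l), forall q, I q -> mx_meval A q = 0,
        A i \in unitmx & mx_meval A p <> 0].
Proof.
move=> idI nI; set x := 'X_i in nI.
have [||J [idJ [subJ nJ]] Jmax] := @exists_maximal_ideal r k
  (fun J => (forall q, I q -> J q) /\ forall N, ~ J (x ^+ N * p)) I => //.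
have larger s : ~ J s -> exists N t, J (x ^+ N * p - t * s).
  move=> nJs; apply: NNPP => no; apply: nJs.
  apply: (Jmax _ (ideal_adjoin idJ s)).
  - split=> [q /subJ Jq|N [t Jt]]; first by exists 0; rewrite mul0r subr0.
    by apply: no; exists N, t.
  - by move=> q Jq; exists 0; rewrite mul0r subr0.
  - by exists 1; rewrite mul1r subrr; apply: ideal0.
(* The annihilator of [p] modulo [J] is prime: by [larger], enlarging [J] by either of two elements
   outside [Q] captures some [x ^+ N * p], and if their product were in [Q] then so would [J]. *)
pose Q s := J (s * p).
have prQ : prime_ideal Q.
  split; first exact: ideal_colon.
    by rewrite /Q mul1r; have := nJ 0%N; rewrite expr0 mul1r.
  move=> a b Qab; apply: NNPP => /Decidable.not_or[nQa nQb].
  have [N [t Jt]] := larger _ nQa; have [M [u Ju]] := larger _ nQb.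
  apply: (nJ (N + M)%N).
  have -> : x ^+ (N + M) * p = x ^+ M * (x ^+ N * p - t * (a * p))
      + t * a * (x ^+ M * p - u * (b * p)) + t * u * (a * b * p) by rewrite exprD; ring.
  apply: idealD => //; last exact: idealMl.
  by apply: idealD => //; apply: idealMl.
have [|a [Qa ai0]] := prime_nullstellensatz prQ (q := x).
  by move=> Qx; apply: (nJ 1%N); rewrite expr1.
rewrite mevalXU in ai0.
(* Otherwise some [x ^+ N - t * y] is in [Q]; it would vanish at [a], where its value is a nonzero
   power of [a i]. *)
have Jvar j : J (('X_j - (a j)%:MP) * p).
  set y := 'X_j - _; apply: NNPP => nJy; have [N [t Jt]] := larger _ nJy.
  have /Qa : Q (x ^+ N - t * y) by rewrite /Q mulrBl -mulrA.
  rewrite /y /x mevalB rmorphXn mevalM mevalB /= !mevalXU mevalC subrr mulr0 subr0.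
  by apply/eqP; rewrite expf_neq0.
(* Let the colons of [J] by the powers of [y] be stable from [n] on. If [y ^+ n] is not in [J], some
   [x ^+ N * p - t * y ^+ n] is. Multiplied by [y], which kills [p], it puts [t * y ^+ n.+1] in [J],
   hence [t * y ^+ n] by stability, hence [x ^+ N * p]: a contradiction. *)
have Jnil j : exists N, J (('X_j - (a j)%:MP) ^+ N).
  set y := 'X_j - _; have [m|m q|n stab] := @noetherian_chain r k (fun m q => J (q * y ^+ m)).
  - exact: ideal_colon.
  - by rewrite exprSr mulrA; apply: idealMr.
  exists n; apply: NNPP => /larger[N [t Jt]]; apply: (nJ N).
  apply: (idealBr idJ Jt); apply: stab.
  have -> : t * y ^+ n.+1 = x ^+ N * (y * p) - y * (x ^+ N * p - t * y ^+ n) by rewrite exprS; ring.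
  by apply: idealB => //; apply: idealMl => //; apply: Jvar.
have [n [b span_b]] := nilpotent_spans idJ Jnil.
have J1 : ~ J 1 by move=> J1; apply: (nJ 0%N); rewrite expr0; apply: (idealMr idJ).
have [m [A [commA kerA]]] := quotient_matrices idJ span_b J1.
exists m, A; split=> //; first by move=> q /subJ /kerA.
  have [N /kerA JN] := Jnil i; have c0 := expf_neq0 N ai0.
  set z := 'X_i - _ in JN.
  (* The geometric sum that inverts [x], up to the scalar [a i ^+ N], because [x] is [a i] minus the
     nilpotent [- z]. *)
  pose u := \sum_(j < N) ((a i)%:MP ^+ (N.-1 - j) * (- z) ^+ j).
  have xu : x * u = (a i ^+ N)%:MP - (- z) ^+ N.
    by rewrite rmorphXn subrXX /z opprK addrC subrK.
  have zN : mx_meval A ((- z) ^+ N) = 0 by rewrite exprNn (mx_mevalM commA) JN mulr0.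
  have : A i * mx_meval A u = (a i ^+ N)%:M.
    rewrite -(mx_mevalXU A) -(mx_mevalM commA) xu.
    by rewrite /mx_meval mmapB -/(mx_meval A _) mx_mevalC -/(mx_meval A _) zN subr0.
  move=> AU; have : A i *m (a i ^- N *: mx_meval A u) = 1%:M.
    by rewrite -scalemxAr [_ *m _]AU scale_scalar_mx mulVf.
  by case/mulmx1_unit.
by move=> /kerA Jp; apply: (nJ 0%N); rewrite expr0 mul1r.
Qed.

End ResidualFiniteness.

(** * Closed subschemes and saturation *)

Section Saturation.
Context (r : nat).
Implicit Types (F G : seq {mpoly algC[r]}) (I : {mpoly algC[r]} -> Prop).
Implicit Types (p q f : {mpoly algC[r]}) (M : 'M[algC]_r).

Lemma in_ideal_ideal F : ideal (in_ideal F).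
Proof.
split; first by exists (fun=> 0); rewrite big1 // => i _; rewrite mul0r.
- move=> p q [c ->] [d ->]; exists (fun i => c i + d i).
  by rewrite -big_split; apply: eq_bigr => i _; rewrite mulrDl.
- move=> a p [c ->]; exists (fun i => a * c i).
  by rewrite mulr_sumr; apply: eq_bigr => i _; rewrite mulrA.
Qed.

Lemma in_ideal_nth F i : in_ideal F F`_i.
Proof.
case: (ltnP i (size F)) => lti; last first.
  by rewrite nth_default //; apply: ideal0 (in_ideal_ideal F).
exists (fun j => (j == Ordinal lti)%:R); rewrite (bigD1 (Ordinal lti)) //= eqxx mul1r.
by rewrite big1 ?addr0 // => j /negPf ->; rewrite mul0r.
Qed.

Lemma in_ideal_mem F f : f \in F -> in_ideal F f.
Proof. by move=> /(nthP 0)[i _ <-]; apply: in_ideal_nth. Qed.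

Lemma in_ideal_min F I p : ideal I -> (forall f, f \in F -> I f) -> in_ideal F p -> I p.
Proof.
move=> idI FI [c ->]; apply: ideal_sum => // i _; apply: (idealMl idI).
by apply/FI/mem_nth.
Qed.

(** Saturation by the irrelevant ideal, tested on one variable at a time. *)
Definition saturation I p : Prop := forall i, exists N, I ('X_i ^+ N * p).

Lemma colon_exp_leq I p y m n : ideal I -> (m <= n)%N -> I (y ^+ m * p) -> I (y ^+ n * p).
Proof. by move=> idI /subnK <- Iy; rewrite exprD -mulrA; apply: idealMl. Qed.

(** The radical of the colon of [I] by [p]. Its closure under combinations leads from the variables
    to all forms of positive degree, and to other coordinate systems. *)
Lemma colon_radical_ideal I p : ideal I -> ideal (fun y => exists N, I (y ^+ N * p)).
Proof.
move=> idI; split; first by exists 1%N; rewrite expr1 mul0r; apply: ideal0.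
- move=> y z [N Iy] [M Iz]; exists (N + M)%N; rewrite exprDn mulr_suml.
  apply: ideal_sum => // i _; rewrite mulrnAl -mulr_natl; apply: (idealMl idI).
  case: (leqP M i) => [leMi|ltiM].
    by rewrite -mulrA; apply: (idealMl idI); apply: colon_exp_leq idI leMi Iz.
  rewrite mulrAC; apply: (idealMr idI); apply: colon_exp_leq idI _ Iy.
  by rewrite -addnBA ?leq_addr // ltnW.
- move=> a y [N Iy]; exists N; rewrite exprMn -mulrA; exact: idealMl.
Qed.

Lemma saturation_ideal I : ideal I -> ideal (saturation I).
Proof.
move=> idI; split; first by move=> i; exists 0%N; rewrite mulr0; apply: ideal0.
- move=> p q sp sq i; have [[N Ip] [M Iq]] := (sp i, sq i).
  exists (N + M)%N; rewrite mulrDr; apply: idealD => //.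
    by apply: colon_exp_leq idI _ Ip; apply: leq_addr.
  by apply: colon_exp_leq idI _ Iq; apply: leq_addl.
- by move=> a p sp i; have [N Ip] := sp i; exists N; rewrite mulrCA; apply: idealMl.
Qed.

Lemma saturation_homog I p h d : ideal I -> saturation I p -> (0 < d)%N -> h \is d.-homog ->
  exists N, I (h ^+ N * p).
Proof.
move=> idI sp d0 /dhomogP homh; have idR := colon_radical_ideal p idI.
suff: exists N, I ((\sum_(m <- msupp h) h@_m *: 'X_[m]) ^+ N * p) by rewrite -mpolyE.
rewrite big_seq; apply: (ideal_sum (I := fun y => exists N, I (y ^+ N * p)) idR) => m mh.
have /existsP[i mi] : [exists i, m i != 0%N].
  have dm : mdeg m = d by exact: homh.
  apply: contraLR d0 => /existsPn m0; rewrite -dm mdegE big1 // => i _.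
  by apply/eqP; rewrite -[_ == _]negbK m0.
have -> : m = (m - U_(i) + U_(i))%MM by rewrite submK // lep1mP.
rewrite -mul_mpolyC mpolyXD mulrA.
exact: (idealMl idR _ (sp i)).
Qed.

(** The quotient of [f] by ['X_i ^+ e] is a section for [F], hence of the form [b / 'X_i ^+ m] with
    [b] in the ideal of [G]; it remains to clear denominators. *)
Lemma ideal_sheaf_saturation F G f i e :
    (forall q : {fraction {mpoly algC[r]}}, ideal_sheaf F 1 'X_i q -> ideal_sheaf G 1 'X_i q) ->
    in_ideal F f -> f \is e.-homog ->
  exists N, in_ideal G ('X_i ^+ N * f).
Proof.
move=> FG Ff homf; have X0 : 'X_i != 0 :> {mpoly algC[r]}.
  by rewrite -msupp_eq0 msuppX.
have [|m [b [_ Gb]]] := FG (tofrac f / tofrac 'X_i ^+ e).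
  by exists e, f; rewrite muln1.
move/eqP; rewrite -!tofracXn eqr_div ?tofrac_eq0 ?expf_neq0 // -!tofracM tofrac_eq.
move=> /eqP fb; exists m; rewrite mulrC fb.
exact: (idealMr (in_ideal_ideal G)).
Qed.

Lemma saturation_ideal_sheaf F G d h (q : {fraction {mpoly algC[r]}}) : (0 < d)%N -> h != 0 -> h \is d.-homog ->
    (forall f, f \in F -> saturation (in_ideal G) f) ->
  ideal_sheaf F d h q -> ideal_sheaf G d h q.
Proof.
move=> d0 h0 homh FG [n [a [homa Fa ->]]].
have /(saturation_homog (in_ideal_ideal G))/(_ d0 homh)[N GN] : saturation (in_ideal G) a.
  by apply: in_ideal_min FG Fa; apply: saturation_ideal; apply: in_ideal_ideal.
exists (N + n)%N, (h ^+ N * a); split=> //.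
  by rewrite mulnDl; apply: dhomogM => //; rewrite mulnC; apply: dhomogMn.
by rewrite tofracM tofracXn exprD -mulf_div divff ?mul1r // expf_neq0 // tofrac_eq0.
Qed.

Lemma same_subscheme_saturation F G : homogeneous_system F -> homogeneous_system G ->
  same_subscheme F G <->
  (forall f, f \in F -> saturation (in_ideal G) f) /\
  (forall f, f \in G -> saturation (in_ideal F) f).
Proof.
move=> homF homG; have X0 i : 'X_i != 0 :> {mpoly algC[r]} by rewrite -msupp_eq0 msuppX.
have homX i : ('X_i : {mpoly algC[r]}) \is 1.-homog by rewrite dhomogX; apply/eqP; apply: mdeg1.
split=> [same|[FG GF] d h d0 h0 homh q]; last by split; apply: saturation_ideal_sheaf.
split=> f f_in i.
  have [e home] := homF f f_in; apply: ideal_sheaf_saturation (in_ideal_mem f_in) home => q.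
  by case: (same 1%N 'X_i isT (X0 i) (homX i) q).
have [e home] := homG f f_in; apply: ideal_sheaf_saturation (in_ideal_mem f_in) home => q.
by case: (same 1%N 'X_i isT (X0 i) (homX i) q).
Qed.

(** * Linear changes of coordinates *)

HB.instance Definition _ M := GRing.RMorphism.copy (subst_linear M)
  (comp_mpoly [tuple \sum_(j < r) M i j *: 'X_j | i < r]).

Lemma subst_linearX M i : subst_linear M 'X_i = \sum_j M i j *: 'X_j.
Proof. by rewrite /subst_linear comp_mpolyXU -tnth_nth tnth_mktuple. Qed.

Lemma subst_linearC M c : subst_linear M c%:MP = c%:MP.
Proof. exact: comp_mpolyC. Qed.

Lemma subst_linearZ M c p : subst_linear M (c *: p) = c *: subst_linear M p.
Proof. exact: comp_mpolyZ. Qed.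

Lemma subst_linear_comp M N p : subst_linear M (subst_linear N p) = subst_linear (N *m M) p.
Proof.
pose phi : {rmorphism {mpoly algC[r]} -> {mpoly algC[r]}} :=
  GRing.RMorphism.clone _ _ (subst_linear M \o subst_linear N) _.
apply: (@mpoly_rmorph_ext _ _ _ phi (subst_linear (N *m M))) => [c|i] /=.
  by rewrite !subst_linearC.
rewrite !subst_linearX rmorph_sum /=.
under eq_bigr => j _ do rewrite subst_linearZ subst_linearX scaler_sumr.
rewrite exchange_big; apply: eq_bigr => l _ /=; rewrite mxE scaler_suml.
by apply: eq_bigr => j _; rewrite scalerA.
Qed.

Lemma subst_linear1 p : subst_linear 1%:M p = p.
Proof.
apply: (@mpoly_rmorph_ext _ _ _ (subst_linear 1%:M) idfun) => [c|i] /=.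
  exact: subst_linearC.
rewrite subst_linearX (bigD1 i) //= big1 => [|j ji]; first by rewrite mxE eqxx scale1r addr0.
by rewrite mxE eq_sym (negPf ji) scale0r.
Qed.

Lemma subst_linear_homog M p d : p \is d.-homog -> subst_linear M p \is d.-homog.
Proof.
move=> /dhomogP homp; rewrite /subst_linear comp_mpolyEX big_seq rpred_sum // => m mp.
have <- : mdeg m = d by exact: homp.
rewrite mdegE comp_mpolyX; apply: rpredZ.
have lin i : tnth [tuple \sum_(j < r) M i j *: 'X_j | i < r] i \is 1.-homog.
  rewrite tnth_mktuple rpred_sum // => j _; apply: rpredZ.
  by rewrite dhomogX; apply/eqP; apply: mdeg1.
move: lin; move: (tnth _) => l lin.
elim: (index_enum _) => [|i s IHs]; first by rewrite !big_nil dhomog1.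
by rewrite !big_cons; apply: dhomogM => //; have := dhomogMn (m i) (lin i); rewrite mul1n.
Qed.

Lemma translate_homog M F : homogeneous_system F -> homogeneous_system (translate M F).
Proof.
move=> homF _ /mapP[f /homF[d homf] ->]; exists d; exact: subst_linear_homog.
Qed.

(** Saturation refers to the coordinates, which [M] moves; but each variable is a combination of the
    images of the variables, and the radical of a colon ideal is closed under combinations. *)
Lemma saturation_subst M I I' p : ideal I' -> M \in unitmx ->
    (forall q, I q -> I' (subst_linear M q)) ->
  saturation I p -> saturation I' (subst_linear M p).
Proof.
move=> idI' uM II' sp j; have idR := colon_radical_ideal (subst_linear M p) idI'.
have -> : 'X_j = \sum_i (invmx M) j i *: subst_linear M 'X_i.
  rewrite -[LHS]subst_linear1 -(mulVmx uM) -subst_linear_comp subst_linearX rmorph_sum.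
  by apply: eq_bigr => i _; rewrite /= subst_linearZ.
apply: (ideal_sum (I := fun y => exists N, I' (y ^+ N * subst_linear M p)) idR) => i _.
have [N IN] := sp i; rewrite -mul_mpolyC; apply: (idealMl idR); exists N.
by rewrite -rmorphXn -rmorphM; apply: II'.
Qed.

Lemma ideal_subst M I : ideal I -> ideal (fun q => I (subst_linear M q)).
Proof.
move=> idI; split; first by rewrite rmorph0; apply: ideal0.
- by move=> p q Ip Iq; rewrite rmorphD; apply: idealD.
- by move=> a p Ip; rewrite rmorphM; apply: idealMl.
Qed.

(* [M] maps the subscheme defined by [G] into the one defined by [F]. *)
Definition included M F G : Prop :=
  exists N, forall f i, f \in F -> in_ideal G ('X_i ^+ N * subst_linear M f).

(** There are finitely many equations and variables, so one exponent serves for all; a finite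
    certificate can record it. *)
Lemma includedP M F G :
  included M F G <-> forall f, f \in F -> saturation (in_ideal G) (subst_linear M f).
Proof.
split=> [[N GN] f fF i|sat]; first by exists N; apply: GN.
have /choice_fun[N NP] : forall i : 'I_r, exists N, forall f, f \in F ->
    in_ideal G ('X_i ^+ N * subst_linear M f).
  move=> i; elim: F sat => [|f F IHF] sat; first by exists 0%N.
  have [|N NP] := IHF; first by move=> h hF; apply: sat; rewrite inE hF orbT.
  have [|N' N'P] := sat f _ i; first by rewrite inE eqxx.
  exists (N + N')%N => h; rewrite inE => /orP[/eqP ->|/NP GN].
    by apply: colon_exp_leq (in_ideal_ideal G) _ N'P; apply: leq_addl.
  by apply: colon_exp_leq (in_ideal_ideal G) _ GN; apply: leq_addr.
exists (\sum_i N i)%N => f i fF; apply: colon_exp_leq (in_ideal_ideal G) _ (NP i f fF).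
by rewrite (bigD1 i) //= leq_addr.
Qed.

(** The inverse is a matrix of its own, so that every condition is polynomial in the entries. *)
Definition linearly_equivalent F G : Prop :=
  exists M M', [/\ M *m M' = 1%:M, included M' F G & included M G F].

Lemma linearly_equivalentP F G : homogeneous_system F -> homogeneous_system G ->
  linearly_equivalent F G <-> projectively_equivalent F G.
Proof.
move=> homF homG.
have tr M f : M \in unitmx -> saturation (in_ideal (translate M F)) f <->
    saturation (in_ideal F) (subst_linear M f).
  move=> uM; split=> sat_f.
    apply: (saturation_subst (in_ideal_ideal F) uM _ sat_f) => q.
    apply: (in_ideal_min (ideal_subst M (in_ideal_ideal F))) => _ /mapP[h hF ->].
    by rewrite subst_linear_comp mulVmx // subst_linear1; apply: in_ideal_mem.
  rewrite -[f]subst_linear1 -(mulmxV uM) -subst_linear_comp.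
  apply: (saturation_subst (in_ideal_ideal _) _ _ sat_f) => [|q].
    by rewrite unitmx_inv.
  apply: (in_ideal_min (ideal_subst (invmx M) (in_ideal_ideal _))) => h hF.
  by apply: in_ideal_mem; apply: map_f.
split=> [[M [M' [MM' incF incG]]]|[M uM]].
  have [uM uM'] := mulmx1_unit MM'; exists M => //.
  have EM' : invmx M = M' by rewrite -[RHS]mul1mx -(mulVmx uM) -mulmxA MM' mulmx1.
  apply/same_subscheme_saturation => //; first exact: translate_homog.
  split=> [_ /mapP[f fF ->]|f fG]; first by rewrite EM'; move/includedP: incF; apply.
  by apply/tr => //; move/includedP: incG; apply.
move=> /same_subscheme_saturation[||satF satG] //; first exact: translate_homog.
exists M, (invmx M); split; first exact: mulmxV.
  by apply/includedP => f fF; apply: satF; apply: map_f.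
by apply/includedP => f fG; apply/tr => //; apply: satG.
Qed.

End Saturation.

(** * Matrix points detect inclusion *)

Section Tests.
Context (r : nat).
Implicit Types (F G : seq {mpoly algC[r]}) (M : 'M[algC]_r).

Definition lin_mx n M (A : 'I_r -> 'M[algC]_n.+1) (i : 'I_r) : 'M[algC]_n.+1 :=
  \sum_j M i j *: A j.

(* A point, with values in matrices, of the complement of the origin in the
   affine cone over the subscheme defined by [F]. *)
Definition matrix_point n F (A : 'I_r -> 'M[algC]_n.+1) : Prop :=
  [/\ forall i j, GRing.comm (A i) (A j), forall f, f \in F -> mx_meval A f = 0 &
      exists i, A i \in unitmx].

Lemma mx_meval_subst n M (A : 'I_r -> 'M[algC]_n.+1) f :
    (forall i j, GRing.comm (A i) (A j)) ->
  mx_meval A (subst_linear M f) = mx_meval (lin_mx M A) f.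
Proof.
move=> commA; rewrite /subst_linear mx_meval_comp //; apply: eq_mx_meval => i.
rewrite tnth_mktuple mx_meval_sum; apply: eq_bigr => j _.
by rewrite mx_mevalZ mx_mevalXU.
Qed.

(** A multiple of f(Mx) by a power of each variable vanishes at [A], and the power of an invertible
    [A i] cancels. *)
Lemma included_matrix_point n M F G (A : 'I_r -> 'M[algC]_n.+1) f :
    included M F G -> matrix_point G A -> f \in F ->
  mx_meval (lin_mx M A) f = 0.
Proof.
move=> [N GN] [commA AG [i uAi]] fF; rewrite -mx_meval_subst //.
have : mx_meval A ('X_i ^+ N * subst_linear M f) = 0.
  apply: (in_ideal_min (I := fun p => mx_meval A p = 0)) (GN f i fF) => //.
  split=> [|p q p0 q0|a p p0]; first by rewrite -(scale0r 0) mx_mevalZ scale0r.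
    by rewrite mx_mevalD p0 q0 addr0.
  by rewrite (mx_mevalM commA) p0 mulr0.
rewrite (mx_mevalM commA) (mx_mevalXn commA) mx_mevalXU => A0.
have uN : A i ^+ N \is a GRing.unit by rewrite unitrX.
by rewrite -[LHS](mulKr uN) A0 mulr0.
Qed.

Lemma matrix_point_included M F G :
    (forall n (A : 'I_r -> 'M[algC]_n.+1) f, matrix_point G A -> f \in F ->
       mx_meval (lin_mx M A) f = 0) ->
  included M F G.
Proof.
move=> pts; apply/includedP => f fF i; apply: NNPP => no.
have [|n [A [commA AG uA Af]]] := residually_finite (in_ideal_ideal G) (i := i)
    (p := subst_linear M f).
  by move=> N GN; apply: no; exists N.
apply: Af; rewrite mx_meval_subst //; apply: pts => //; split=> //; last by exists i.
by move=> h /in_ideal_mem; apply: AG.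
Qed.

End Tests.

(** * Certificates *)

Ltac computability_seq := lazymatch goal with
  | |- computable (fun z => foldr (@?f z) (@?a z) (@?s z)) => apply: computable_foldr
  | |- computable (fun z => map (@?f z) (@?s z)) => apply: computable_map
  | |- computable (fun z => all (@?p z) (@?s z)) => apply: computable_all
  | |- computable (fun z => nth ?x (@?s z) (@?i z)) => apply: computable_nth
  | |- computable (fun z => iota 0%N (@?n z)) => apply: computable_iota0
  | |- computable (fun z => cat (@?s z) (@?t z)) => apply: computable_cat
  | |- computable (fun z => flatten (@?s z)) => apply: computable_flatten
  | |- computable (fun z => size (@?s z)) => apply: computable_size
  | |- computable (fun z => iter (@?m z) (@?f z) (@?a z)) => apply: computable_iter
  | |- computable (fun z => enc (@?a z)) => apply: computable_enc
  | |- _ => first [computability_code | apply: computable_if]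
  end.
Ltac computability_extra ::= first [assumption
  | match goal with
    | H : computable ?f |- computable (fun z => ?f (@?g z)) => apply: (computable_comp H)
    end
  | computability_seq].

Lemma big_iota0 (R : Type) (idx : R) (op : R -> R -> R) n (F : nat -> R) :
  \big[op/idx]_(i <- iota 0 n) F i = \big[op/idx]_(i < n) F i.
Proof. by rewrite -(big_mkord xpredT) /index_iota subn0. Qed.

(** * Matrices and polynomials over codes of scalars *)

Section Codes.
Context (nu : nat -> algC) (addc mulc : nat -> nat -> nat) (zeroc onec negc : nat).
Hypotheses (nuD : forall a b, nu (addc a b) = nu a + nu b)
  (nuM : forall a b, nu (mulc a b) = nu a * nu b)
  (nu0 : nu zeroc = 0) (nu1 : nu onec = 1) (nuN1 : nu negc = -1)
  (nu_surj : forall x, exists c, nu c = x).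

(** Missing entries read as zero, so every list of lists codes a matrix of every size and no
    certificate has to be checked for shape. *)
Definition entry (A : seq (seq nat)) (i j : nat) : nat := nth zeroc (nth [::] A i) j.
Definition mkmx n (f : nat -> nat -> nat) : seq (seq nat) :=
  [seq [seq f i j | j <- iota 0 n] | i <- iota 0 n].
Definition sumc (s : seq nat) : nat := foldr addc zeroc s.
Definition expc (c N : nat) : nat := iter N (mulc c) onec.
Definition mx_add n A B := mkmx n (fun i j => addc (entry A i j) (entry B i j)).
Definition mx_mul n A B :=
  mkmx n (fun i j => sumc [seq mulc (entry A i k) (entry B k j) | k <- iota 0 n]).
Definition mx_scale n c A := mkmx n (fun i j => mulc c (entry A i j)).
Definition mx_one n := mkmx n (fun i j => if i == j then onec else zeroc).
Definition mx_zero n := mkmx n (fun _ _ => zeroc).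
Definition mx_eq n A B :=
  all (fun i => all (fun j => nu (entry A i j) == nu (entry B i j)) (iota 0 n)) (iota 0 n).
Definition mx_exp n A e := iter e (mx_mul n A) (mx_one n).
Definition mx_sum n s := foldr (mx_add n) (mx_zero n) s.
Definition mx_prod n s := foldr (mx_mul n) (mx_one n) s.
Definition mx_comb n r M (As : seq (seq (seq nat))) :=
  [seq mx_sum n [seq mx_scale n (entry M i j) (nth [::] As j) | j <- iota 0 r] | i <- iota 0 r].
Definition mx_poly n r (p : poly_data) (As : seq (seq (seq nat))) :=
  mx_sum n [seq mx_scale n t.1 (mx_prod n
    [seq mx_exp n (nth [::] As i) (nth 0%N t.2 i) | i <- iota 0 r]) | t <- p].

(* Scalars are evaluated as matrices of size 1. *)
Definition point_mx (X : seq nat) := [seq [:: [:: c]] | c <- X].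
Definition peval r p X := entry (mx_poly 1 r p (point_mx X)) 0 0.
Definition psubst r M p X := entry (mx_poly 1 r p (mx_comb 1 r M (point_mx X))) 0 0.

Definition mxof n (A : seq (seq nat)) : 'M[algC]_n := \matrix_(i, j) nu (entry A i j).
Definition mxs_of n r (As : seq (seq (seq nat))) (i : 'I_r) : 'M[algC]_n :=
  mxof n (nth [::] As i).
Definition coord r (X : seq nat) (i : 'I_r) : algC := nu (nth zeroc X i).

Lemma entry_mkmx n f i j : entry (mkmx n f) i j = if (i < n)%N && (j < n)%N then f i j else zeroc.
Proof.
rewrite /entry /mkmx; case: (ltnP i n) => lti /=; last first.
  by rewrite [nth _ _ i]nth_default ?size_map ?size_iota // nth_nil.
rewrite (nth_map 0%N) ?size_iota // nth_iota // add0n.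
case: (ltnP j n) => ltj; last by rewrite nth_default ?size_map ?size_iota.
by rewrite (nth_map 0%N) ?size_iota // nth_iota.
Qed.

Lemma mxof_mkmx n f : mxof n (mkmx n f) = \matrix_(i, j) nu (f i j).
Proof. by apply/matrixP => i j; rewrite !mxE entry_mkmx !ltn_ord. Qed.

Lemma nu_sumc s : nu (sumc s) = \sum_(c <- s) nu c.
Proof. by elim: s => [|c s IHs]; rewrite ?big_nil ?big_cons //= nuD IHs. Qed.

Lemma nu_expc c N : nu (expc c N) = nu c ^+ N.
Proof. by elim: N => [|N IHN]; rewrite ?expr0 // exprS /= nuM IHN. Qed.

Lemma mxof_add n A B : mxof n (mx_add n A B) = mxof n A + mxof n B.
Proof. by rewrite mxof_mkmx; apply/matrixP => i j; rewrite !mxE nuD. Qed.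

Lemma mxof_mul n A B : mxof n (mx_mul n A B) = mxof n A *m mxof n B.
Proof.
rewrite mxof_mkmx; apply/matrixP => i j; rewrite !mxE nu_sumc big_map big_iota0; apply: eq_bigr => l _.
by rewrite nuM !mxE.
Qed.

Lemma mxof_scale n c A : mxof n (mx_scale n c A) = nu c *: mxof n A.
Proof. by rewrite mxof_mkmx; apply/matrixP => i j; rewrite !mxE nuM. Qed.

Lemma mxof_one n : mxof n (mx_one n) = 1%:M.
Proof.
rewrite mxof_mkmx; apply/matrixP => i j; rewrite !mxE.
by rewrite (_ : (nat_of_ord i == j) = (i == j)) //; case: (i == j).
Qed.

Lemma mxof_zero n : mxof n (mx_zero n) = 0.
Proof. by rewrite mxof_mkmx; apply/matrixP => i j; rewrite !mxE. Qed.

Lemma mx_eqP n A B : reflect (mxof n A = mxof n B) (mx_eq n A B).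
Proof.
apply: (iffP allP) => [eqAB|/matrixP eqAB i].
  apply/matrixP => i j; have /eqAB/allP : nat_of_ord i \in iota 0 n by rewrite mem_iota ltn_ord.
  by move=> /(_ (nat_of_ord j)); rewrite mem_iota ltn_ord !mxE => /(_ isT)/eqP.
rewrite mem_iota add0n /= => lti; apply/allP => j; rewrite mem_iota add0n /= => ltj.
by have := eqAB (Ordinal lti) (Ordinal ltj); rewrite !mxE => ->.
Qed.

Lemma mxof_exp n A e : mxof n.+1 (mx_exp n.+1 A e) = mxof n.+1 A ^+ e.
Proof.
elim: e => [|e IHe]; first by rewrite expr0 mxof_one.
by rewrite exprS /= mxof_mul IHe.
Qed.

Lemma mxof_sum n s : mxof n (mx_sum n s) = \sum_(A <- s) mxof n A.
Proof.
by elim: s => [|A s IHs]; rewrite ?big_nil ?mxof_zero // big_cons /= mxof_add IHs.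
Qed.

Lemma mxof_prod n s : mxof n.+1 (mx_prod n.+1 s) = \prod_(A <- s) mxof n.+1 A.
Proof.
by elim: s => [|A s IHs]; rewrite ?big_nil ?mxof_one // big_cons /= mxof_mul IHs.
Qed.

Lemma mxs_of_comb n r M As i : @mxs_of n.+1 r (mx_comb n.+1 r M As) i =
  lin_mx (mxof r M) (@mxs_of n.+1 r As) i.
Proof.
rewrite /mxs_of /mx_comb (nth_map 0%N) ?size_iota // nth_iota // mxof_sum big_map add0n big_iota0; apply: eq_bigr => j _.
by rewrite mxof_scale mxE.
Qed.

Lemma mxof_poly n r p As :
  mxof n.+1 (mx_poly n.+1 r p As) = mx_meval (@mxs_of n.+1 r As) (poly_of nu r p).
Proof.
rewrite /mx_poly mxof_sum big_map /poly_of mx_meval_sum; apply: eq_bigr => t _.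
rewrite mxof_scale mx_mevalZ mx_mevalX mxof_prod big_map big_iota0; congr (_ *: _); apply: eq_bigr => i _.
by rewrite mxof_exp mnmE.
Qed.

Lemma mx_meval_scalar n r (x : 'I_r -> algC) p :
  mx_meval (fun i => (x i)%:M : 'M_n.+1) p = (p.@[x])%:M.
Proof.
rewrite mevalE raddf_sum; apply: eq_bigr => m _ /=.
rewrite scalar_mxM; congr (_ *m _); rewrite rmorph_prod; apply: eq_bigr => i _ /=.
by rewrite rmorphXn.
Qed.

Lemma mxs_of_point n r X i : n = 0%N -> @mxs_of n.+1 r (point_mx X) i = (coord X i)%:M.
Proof.
move=> ->; apply/matrixP => a b; rewrite !mxE !ord1 eqxx mulr1n /coord /entry.
case: (ltnP i (size X)) => lti; first by rewrite (nth_map zeroc).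
by rewrite ![nth _ _ (nat_of_ord i)]nth_default ?size_map.
Qed.

Lemma nu_peval r p X : nu (peval r p X) = (poly_of nu r p).@[@coord r X].
Proof.
have -> : nu (peval r p X) = mxof 1 (mx_poly 1 r p (point_mx X)) 0 0 by rewrite mxE.
rewrite mxof_poly (eq_mx_meval _ (fun i => mxs_of_point X i (erefl 0%N))).
by rewrite mx_meval_scalar mxE.
Qed.

Lemma nu_psubst r M p X :
  nu (psubst r M p X) = (subst_linear (mxof r M) (poly_of nu r p)).@[@coord r X].
Proof.
have -> : nu (psubst r M p X) =
    mxof 1 (mx_poly 1 r p (mx_comb 1 r M (point_mx X))) 0 0 by rewrite mxE.
have eqX := fun i : 'I_r => mxs_of_point X i (erefl 0%N).
rewrite mxof_poly (eq_mx_meval _ (mxs_of_comb _ _ _)) -mx_meval_subst.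
  by rewrite (eq_mx_meval _ eqX) mx_meval_scalar mxE.
by move=> i j; rewrite !eqX; apply: scalar_mxC.
Qed.

Lemma poly_of_surj r (P : {mpoly algC[r]}) : exists p, poly_of nu r p = P.
Proof.
have [code codeK] := choice_fun nu_surj.
exists [seq (code P@_m, [seq m i | i <- enum 'I_r]) | m : 'X_{1..r} <- msupp P].
rewrite /poly_of big_map [RHS]mpolyE; apply: eq_bigr => m _ /=.
rewrite codeK; congr (_ *: 'X_[_]); apply/mnmP => i.
by rewrite mnmE (nth_map i) ?size_enum_ord // nth_ord_enum.
Qed.

Lemma mxof_surj n (A : 'M[algC]_n) : exists C, mxof n C = A.
Proof.
have [code codeK] := choice_fun nu_surj.
case: n A => [|n] A; first by exists [::]; apply/matrixP => [] [].
exists (mkmx n.+1 (fun i j => code (A (inord i) (inord j)))); rewrite mxof_mkmx.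
by apply/matrixP => i j; rewrite mxE codeK !inord_val.
Qed.

Lemma mxs_of_surj n r (A : 'I_r -> 'M[algC]_n) : exists C, @mxs_of n r C =1 A.
Proof.
have [code codeK] := choice_fun (@mxof_surj n).
exists [seq code (A i) | i <- enum 'I_r] => i.
by rewrite /mxs_of (nth_map i) ?size_enum_ord // nth_ord_enum codeK.
Qed.

Lemma coord_surj r (x : 'I_r -> algC) : exists X, @coord r X =1 x.
Proof.
have [code codeK] := choice_fun nu_surj; exists [seq code (x i) | i <- enum 'I_r] => i.
by rewrite /coord (nth_map i) ?size_enum_ord // nth_ord_enum codeK.
Qed.

(** * Identity testing on a grid *)

Definition natc k := iter k (addc onec) zeroc.
Definition grid D m : seq (seq nat) :=
  iter m (fun P => [seq natc k :: X | k <- iota 0 D.+1, X <- P]) [:: [::]].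

Lemma nu_natc k : nu (natc k) = k%:R.
Proof. by elim: k => //= k IHk; rewrite nuD nu1 IHk -natr1 addrC. Qed.

Lemma mem_grid D s : all (fun k => k <= D)%N s -> map natc s \in grid D (size s).
Proof.
elim: s => // k s IHs /andP[lek /IHs grids].
by apply/allpairsP; exists (k, map natc s); split; rewrite ?mem_iota.
Qed.

(** The coordinates below [j] are arbitrary, the others on the grid; freeing one more leaves a
    polynomial in one variable of degree at most [D] with the [D.+1] roots 0, ..., D, distinct in
    characteristic zero. *)
Lemma grid_eq0 D m (P : {mpoly algC[m]}) : (msize P <= D.+1)%N ->
  (forall X, X \in grid D m -> P.@[@coord m X] = 0) -> P = 0.
Proof.
move=> degP P0; apply/eqP; apply: contraT => /mpoly_nonroot[a]; apply: contraNT => _.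
suff partial j (x : 'I_m -> algC) :
    (forall i : 'I_m, (j <= i)%N -> exists2 e, (e <= D)%N & x i = e%:R) -> P.@[x] = 0.
  by apply/eqP/(partial m) => i; rewrite leqNgt ltn_ord.
elim: j x => [|j IHj] x gridx.
  have /choice_fun[e eP] : forall i, exists e, (e <= D)%N /\ x i = e%:R.
    by move=> i; have [e] := gridx i isT; exists e.
  have gridX : map natc [seq e i | i <- enum 'I_m] \in grid D m.
    rewrite -[X in grid D X](size_enum_ord m) -(size_map e) mem_grid //.
    by apply/allP => _ /mapP[i _ ->]; case: (eP i).
  rewrite -(P0 _ gridX); apply: meval_eq => i.
  rewrite /coord -map_comp (nth_map i) ?size_enum_ord // nth_ord_enum /= nu_natc.
  by case: (eP i).
case: (ltnP j m) => [ltj|lej]; last first.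
  by apply: IHj => i lei; apply: gridx; move: (ltn_ord i); rewrite ltnNge (leq_trans lej).
pose i0 := Ordinal ltj; pose upd t (i : 'I_m) := if i == i0 then t else x i.
pose u := \sum_(mu <- msupp P) (P@_mu * \prod_(i | i != i0) x i ^+ mu i) *: 'X^(mu i0).
have uE t : u.[t] = P.@[upd t].
  rewrite horner_sum mevalE; apply: eq_bigr => mu _; rewrite hornerZ hornerXn.
  rewrite [in RHS](bigD1 i0) //= /upd eqxx [_ ^+ _ * _]mulrC mulrA; congr (_ * _ * _).
  by apply: eq_bigr => i /negPf ->.
have u0 : u = 0.
  apply/eqP; apply: contraT => u_neq0.
  have := max_poly_roots u_neq0 (rs := [seq e%:R | e <- iota 0 D.+1]).
  rewrite size_map size_iota map_inj_uniq ?iota_uniq; last first.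
    by move=> e1 e2 /eqP; rewrite eqr_nat => /eqP.
  have -> : all (root u) [seq e%:R | e <- iota 0 D.+1].
    apply/allP => _ /mapP[e + ->]; rewrite mem_iota add0n /= ltnS => leD.
    apply/rootP; rewrite uE; apply: IHj => i; rewrite leq_eqVlt /upd => /orP[/eqP ji|ltji].
      by rewrite (_ : i = i0) ?eqxx; [exists e | apply: val_inj].
    by rewrite -val_eqE gtn_eqF //; apply: gridx.
  move=> /(_ isT isT); rewrite ltnNge => /negP[]; apply: leq_trans _ degP.
  apply: leq_trans (size_sum _ _ _) _; apply/bigmax_leqP_seq => mu mu_P _.
  apply: leq_trans (size_scale_leq _ _) _; rewrite size_polyXn.
  apply: leq_ltn_trans (msize_mdeg_lt mu_P).
  by rewrite mdegE (bigD1 i0) //= leq_addr.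
have -> : P.@[x] = u.[x i0]; last by rewrite u0 horner0.
by rewrite uE; apply: meval_eq => i; rewrite /upd; case: eqP => // ->.
Qed.

(** * Degree bounds *)

Section Degree.
Context (m : nat).
Implicit Types (p q : {mpoly algC[m]}).

Definition deg_le d p := (msize p <= d.+1)%N.

Lemma deg_leW d e p : (d <= e)%N -> deg_le d p -> deg_le e p.
Proof. by move=> le_de /leq_trans; apply. Qed.

Lemma deg_leC d c : deg_le d c%:MP.
Proof. by rewrite /deg_le msizeC; case: (c == 0). Qed.

Lemma deg_leX i : deg_le 1 'X_i.
Proof. by rewrite /deg_le msizeX mdeg1. Qed.

Lemma deg_leD d p q : deg_le d p -> deg_le d q -> deg_le d (p + q).
Proof. by move=> dp dq; apply: leq_trans (msizeD_le _ _) _; rewrite geq_max; apply/andP. Qed.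

Lemma deg_leM d e p q : deg_le d p -> deg_le e q -> deg_le (d + e) (p * q).
Proof.
rewrite /deg_le; have [->|p0] := eqVneq p 0; first by rewrite mul0r msize0.
have [->|q0] := eqVneq q 0; first by rewrite mulr0 msize0.
move=> dp dq; rewrite msizeM //; have := leq_add dp dq.
by rewrite addSn addnS; case: (_ + _)%N.
Qed.

Lemma deg_leN d p : deg_le d p -> deg_le d (- p).
Proof. by rewrite /deg_le msizeN. Qed.

Lemma deg_leZ d c p : deg_le d p -> deg_le d (c *: p).
Proof. by rewrite -mul_mpolyC -[d in X in _ -> X]add0n; apply/deg_leM/deg_leC. Qed.

Lemma deg_le0 d : deg_le d 0.
Proof. by rewrite /deg_le msize0. Qed.

Lemma deg_le1 d : deg_le d 1.
Proof. exact: deg_leC. Qed.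

Lemma deg_le_sum d (T : Type) (s : seq T) (F : T -> {mpoly algC[m]}) :
  (forall i, deg_le d (F i)) -> deg_le d (\sum_(i <- s) F i).
Proof. by move=> dF; elim/big_rec: _ => [|i p _]; [apply: deg_le0 | apply: deg_leD]. Qed.

Lemma deg_leXn d N p : deg_le d p -> deg_le (N * d) (p ^+ N).
Proof.
move=> dp; elim: N => [|N IHN]; first exact: deg_le1.
by rewrite exprS mulSn; apply: deg_leM.
Qed.

Lemma deg_le_prod (T : Type) (s : seq T) (d : T -> nat) (F : T -> {mpoly algC[m]}) :
  (forall i, deg_le (d i) (F i)) -> deg_le (\sum_(i <- s) d i) (\prod_(i <- s) F i).
Proof.
move=> dF; elim: s => [|i s IHs]; rewrite ?big_nil ?big_cons; first exact: deg_le1.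
exact: deg_leM.
Qed.

End Degree.

(** With the next bounds, this makes the code of a certificate dominate the degrees of all
    polynomials in it. *)
Lemma enc_mem (T : eqType) {cT : coded T} (x : T) s : x \in s -> (enc x <= enc s)%N.
Proof.
elim: s => // y s IHs; rewrite enc_cons inE => /orP[/eqP <-|/IHs les].
  exact: ltnW (ltn_cpair1 _ _).
exact: leq_trans les (ltnW (ltn_cpair _ _)).
Qed.

Lemma enc_fst (T U : Type) {cT : coded T} {cU : coded U} (p : T * U) : (enc p.1 <= enc p)%N.
Proof. by case: p => x y; apply: ltnW (ltn_cpair1 _ _). Qed.

Lemma enc_snd (T U : Type) {cT : coded T} {cU : coded U} (p : T * U) : (enc p.2 <= enc p)%N.
Proof. by case: p => x y; apply: ltnW (ltn_cpair _ _). Qed.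

Lemma enc_nth (T : eqType) {cT : coded T} (s : seq (seq T)) i : (enc (nth [::] s i) <= enc s)%N.
Proof.
case: (ltnP i (size s)) => lti; first exact/enc_mem/mem_nth.
by rewrite nth_default.
Qed.

Lemma sum_nth_enc (s : seq nat) r : (\sum_(i < r) nth 0 s i <= enc s)%N.
Proof.
elim: s r => [|x s IHs] r; first by rewrite big1 // => i _; rewrite nth_nil.
case: r => [|r]; first by rewrite big_ord0.
by rewrite big_ord_recl enc_cons; apply: leq_trans (leq_cpairD _ _); apply: leq_add.
Qed.

Lemma term_deg_enc r (p : poly_data) t : t \in p -> (\sum_(i < r) nth 0 t.2 i <= enc p)%N.
Proof.
move=> tp; apply: leq_trans (sum_nth_enc _ _) _.
exact: leq_trans (enc_snd t) (enc_mem tp).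
Qed.

Lemma deg_le_poly_of r (p : poly_data) : deg_le (enc p) (poly_of nu r p).
Proof.
rewrite /poly_of big_seq; elim/big_rec: _ => [|t q tp dq]; first exact: deg_le0.
apply: deg_leD dq; apply/deg_leZ/(deg_leW (term_deg_enc r tp)).
rewrite mpolyXE_id; apply: deg_le_prod => i; rewrite mnmE -[X in deg_le X]muln1.
exact/deg_leXn/deg_leX.
Qed.

Lemma deg_le_subst r (M : 'M[algC]_r) (p : poly_data) :
  deg_le (enc p) (subst_linear M (poly_of nu r p)).
Proof.
rewrite /poly_of rmorph_sum big_seq; elim/big_rec: _ => [|t q tp dq]; first exact: deg_le0.
apply: deg_leD dq; rewrite /= subst_linearZ; apply/deg_leZ/(deg_leW (term_deg_enc r tp)).
rewrite mpolyXE_id rmorph_prod; apply: deg_le_prod => i; rewrite mnmE rmorphXn.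
rewrite -[X in deg_le X]muln1; apply/deg_leXn; rewrite /= subst_linearX.
by apply: deg_le_sum => j; apply/deg_leZ/deg_leX.
Qed.


(* [l.2] is the index of a generator, multiplied by the polynomial [l.1]. *)
Definition cofactors : Type := seq (poly_data * nat).

(** * Certificates of equivalence *)

Lemma in_ideal_cofactors r (G : system_data) P : in_ideal (system_of nu r G) P <->
  exists L : cofactors,
    P = \sum_(l <- L) poly_of nu r l.1 * poly_of nu r (nth [::] G l.2).
Proof.
(* An index beyond the end of [G] selects the zero polynomial, so every list of cofactors is
   legitimate. *)
have nthG i : poly_of nu r (nth [::] G i) = (system_of nu r G)`_i.
  rewrite /system_of; case: (ltnP i (size G)) => lti; first by rewrite (nth_map [::]).
  by rewrite !nth_default ?size_map // /poly_of big_nil.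
split=> [[c ->]|[L ->]].
  have [code codeK] := choice_fun (@poly_of_surj r).
  exists [seq (code (c i), nat_of_ord i) | i <- enum 'I_(size (system_of nu r G))].
  by rewrite big_map big_enum; apply: eq_bigr => i _; rewrite codeK nthG.
apply: (ideal_sum (in_ideal_ideal _)) => l _; rewrite nthG.
exact: (idealMl (in_ideal_ideal _) _ (in_ideal_nth _ _)).
Qed.

(** [C] is indexed by the equation, then by the variable. [D] is a parameter because correct
    cofactors pass for every [D], whereas soundness requires a large one. *)
Definition incl_ok r M (F G : system_data) N (C : seq (seq cofactors)) D : bool :=
  all (fun X => all (fun a => all (fun i =>
      nu (mulc (expc (nth zeroc X i) N) (psubst r M (nth [::] F a) X)) ==
      nu (sumc [seq mulc (peval r l.1 X) (peval r (nth [::] G l.2) X)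
               | l <- nth [::] (nth [::] C a) i]))
    (iota 0 r)) (iota 0 (size F))) (grid D r).

Lemma incl_ok_sound r M (F G : system_data) N C D :
    (N + enc F <= D)%N -> (enc C + enc G <= D)%N -> incl_ok r M F G N C D ->
  included (mxof r M) (system_of nu r F) (system_of nu r G).
Proof.
move=> leFD leGD /allP ok; exists N => _ i /(nthP 0)[a + <-].
rewrite size_map => lta; rewrite (nth_map [::]) //; apply/in_ideal_cofactors.
set L := nth [::] (nth [::] C a) i; exists L; apply/eqP; rewrite -subr_eq0; apply/eqP.
apply: (grid_eq0 (D := D)) => [|X /ok].
  apply: deg_leD; last apply: deg_leN.
    apply: deg_leW (leFD) _; apply: deg_leM.
      by rewrite -[X in deg_le X]muln1; apply/deg_leXn/deg_leX.
    apply: deg_leW (deg_le_subst _ _); exact/enc_mem/mem_nth.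
  rewrite big_seq; elim/big_rec: _ => [|l p lL]; first exact: deg_le0.
  apply: deg_leD; apply: deg_leW (leGD) _; apply: deg_leM.
    apply: deg_leW (deg_le_poly_of _ _); apply: leq_trans (enc_fst l) _.
    by apply: leq_trans (enc_mem lL) (leq_trans (enc_nth _ _) (enc_nth _ _)).
  apply: deg_leW (deg_le_poly_of _ _).
  case: (ltnP l.2 (size G)) => ltl; first exact/enc_mem/mem_nth.
  by rewrite nth_default.
move/allP/(_ a); rewrite mem_iota add0n => /(_ lta)/allP/(_ (nat_of_ord i)).
rewrite mem_iota add0n ltn_ord => /(_ isT)/eqP.
rewrite nuM nu_expc nu_psubst nu_sumc big_map mevalB mevalM rmorphXn /= mevalXU => ->.
apply/eqP; rewrite subr_eq0 raddf_sum; apply/eqP; apply: eq_bigr => l _.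
by rewrite /= nuM !nu_peval mevalM.
Qed.

Lemma incl_ok_complete r M (F G : system_data) :
    included (mxof r M) (system_of nu r F) (system_of nu r G) ->
  exists N C, forall D, incl_ok r M F G N C D.
Proof.
move=> [N GN]; exists N.
(* The range conditions stand inside the existential, so that choice applies to all pairs of
   numbers. *)
have /choice_fun[L LP] (ai : nat * nat) : exists L : cofactors,
    forall (lta : (ai.1 < size F)%N) (lti : (ai.2 < r)%N),
    'X_(Ordinal lti) ^+ N * subst_linear (mxof r M) (poly_of nu r (nth [::] F ai.1)) =
    \sum_(l <- L) poly_of nu r l.1 * poly_of nu r (nth [::] G l.2).
  case: ai => a i /=; have [lta|] := classic (a < size F)%N; last by exists [::].
  have [lti|] := classic (i < r)%N; last by exists [::].
  have [|L LE] := (in_ideal_cofactors _ _).1 (GN (poly_of nu r (nth [::] F a)) (Ordinal lti) _).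
    by apply/map_f/mem_nth.
  by exists L => _ lti'; rewrite (bool_irrelevance lti' lti).
exists [seq [seq L (a, i) | i <- iota 0 r] | a <- iota 0 (size F)] => D.
apply/allP => X _; apply/allP => a; rewrite mem_iota add0n => lta.
apply/allP => i; rewrite mem_iota add0n => lti.
rewrite (nth_map 0%N) ?size_iota // nth_iota // add0n.
rewrite (nth_map 0%N) ?size_iota // nth_iota // add0n.
have evalE := congr1 (meval (@coord r X)) (LP (a, i) lta lti).
rewrite mevalM rmorphXn /= mevalXU [RHS]raddf_sum in evalE.
rewrite nuM nu_expc nu_psubst nu_sumc big_map evalE.
by apply/eqP/eq_bigr => l _; rewrite /= nuM !nu_peval mevalM.
Qed.

Definition inclusion_cert : Type := nat * seq (seq cofactors).

Definition positive_cert : Type :=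
  seq (seq nat) * (seq (seq nat) * (inclusion_cert * inclusion_cert)).

(** [D] includes [enc c] because the exponents and the degrees of the cofactors are bounded only
    through the certificate. *)
Definition positive_ok (z : nat * system_data * system_data) (c : positive_cert) : bool :=
  let r := z.1.1 in let F := z.1.2 in let G := z.2 in
  let M := c.1 in let M' := c.2.1 in
  let D := (enc c + (enc F + enc G))%N in
  mx_eq r (mx_mul r M M') (mx_one r) &&
  (incl_ok r M' F G c.2.2.1.1 c.2.2.1.2 D && incl_ok r M G F c.2.2.2.1 c.2.2.2.2 D).

Definition instance_equiv (z : nat * system_data * system_data) : Prop :=
  linearly_equivalent (system_of nu z.1.1 z.1.2) (system_of nu z.1.1 z.2).

Lemma positive_ok_sound z c : positive_ok z c -> instance_equiv z.
Proof.
case/and3P => /mx_eqP; rewrite mxof_mul mxof_one => MM' ok1 ok2.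
have le1 := leq_trans (enc_fst c.2.2) (leq_trans (enc_snd c.2) (enc_snd c)).
have le2 := leq_trans (enc_snd c.2.2) (leq_trans (enc_snd c.2) (enc_snd c)).
exists (mxof z.1.1 c.1), (mxof z.1.1 c.2.1); split=> //.
  apply: (incl_ok_sound _ _ ok1); apply: leq_add.
  - by apply: leq_trans (le1 _ _ _ _); apply: (enc_fst c.2.2.1).
  - exact: leq_addr.
  - by apply: leq_trans (le1 _ _ _ _); apply: (enc_snd c.2.2.1).
  - exact: leq_addl.
apply: (incl_ok_sound _ _ ok2); apply: leq_add.
- by apply: leq_trans (le2 _ _ _ _); apply: (enc_fst c.2.2.2).
- exact: leq_addl.
- by apply: leq_trans (le2 _ _ _ _); apply: (enc_snd c.2.2.2).
- exact: leq_addr.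
Qed.

Lemma positive_ok_complete z : instance_equiv z -> exists c, positive_ok z c.
Proof.
case: z => [[r F] G] [M0 [M0' [MM' inc1 inc2]]].
have [[M ME] [M' ME']] := (mxof_surj M0, mxof_surj M0').
rewrite -ME -ME' in MM' inc1 inc2.
have [N [C ok1]] := incl_ok_complete inc1; have [N' [C' ok2]] := incl_ok_complete inc2.
exists (M, (M', ((N, C), (N', C')))); apply/and3P; split=> //.
by apply/mx_eqP; rewrite mxof_mul mxof_one.
Qed.


(* A matrix point: its size minus one, the matrices, and an index with an
   inverse of the corresponding matrix. *)
Definition point_code : Type := nat * (seq (seq (seq nat)) * (nat * seq (seq nat))).

(** * Certificates of non-equivalence *)

Definition point_ok r (F : system_data) (T : point_code) : bool :=
  let n := T.1.+1 in let As := T.2.1 in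
  ((T.2.2.1 < r)%N && mx_eq n (mx_mul n T.2.2.2 (nth [::] As T.2.2.1)) (mx_one n)) &&
  (all (fun i => all (fun j => mx_eq n (mx_mul n (nth [::] As i) (nth [::] As j))
                                       (mx_mul n (nth [::] As j) (nth [::] As i)))
      (iota 0 r)) (iota 0 r) &&
   all (fun f => mx_eq n (mx_poly n r f As) (mx_zero n)) F).

Lemma point_ok_sound r F T : point_ok r F T ->
  matrix_point (system_of nu r F) (@mxs_of T.1.+1 r T.2.1).
Proof.
case/andP => /andP[lti /mx_eqP inv] /andP[/allP comm /allP F0].
rewrite mxof_mul mxof_one in inv; have [_ uA] := mulmx1_unit inv; split.
- move=> i j; have /comm/allP : nat_of_ord i \in iota 0 r by rewrite mem_iota ltn_ord.
  move=> /(_ (nat_of_ord j)); rewrite mem_iota ltn_ord => /(_ isT)/mx_eqP.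
  by rewrite !mxof_mul.
- by move=> _ /mapP[f /F0/mx_eqP + ->]; rewrite mxof_poly mxof_zero.
- by exists (Ordinal lti).
Qed.

Lemma point_ok_complete r F n (A : 'I_r -> 'M[algC]_n.+1) :
    matrix_point (system_of nu r F) A ->
  exists As w, point_ok r F (n, (As, w)) /\ @mxs_of n.+1 r As =1 A.
Proof.
move=> [commA FA [i uA]].
have [As AE] := mxs_of_surj A; have [B BE] := mxof_surj (invmx (A i)).
exists As, (nat_of_ord i, B); split=> //.
apply/andP; split; [apply/andP; split=> //= | apply/andP; split].
- apply/mx_eqP; rewrite mxof_mul mxof_one BE -[X in _ *m X]/(mxs_of _ _ _) AE; exact: mulVmx.
- apply/allP => j; rewrite mem_iota add0n => ltj; apply/allP => l; rewrite mem_iota add0n => ltl.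
  apply/mx_eqP; rewrite !mxof_mul.
  by have := commA (Ordinal ltj) (Ordinal ltl); rewrite -!AE.
- apply/allP => f fF; apply/mx_eqP; rewrite mxof_poly mxof_zero /= (eq_mx_meval _ AE).
  by apply: FA; apply: map_f.
Qed.

(** Row-major reading of the unknowns: offset 0 gives [M], offset [r * r] gives [M']. *)
Definition subgrid r o (W : seq nat) := mkmx r (fun i j => nth zeroc W (o + (i * r + j))).

Definition inverse_value r (W : seq nat) (uv : nat * nat) : nat :=
  entry (mx_add r (mx_mul r (subgrid r 0 W) (subgrid r (r * r) W))
                  (mx_scale r negc (mx_one r))) uv.1 uv.2.

Definition point_item : Type := point_code * (nat * (nat * nat)).

Definition point_value r (F : system_data) o (W : seq nat) (l : point_item) : nat :=
  let n := l.1.1.+1 in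
  entry (mx_poly n r (nth [::] F l.2.1) (mx_comb n r (subgrid r o W) l.1.2.1)) l.2.2.1 l.2.2.2.

(* The unknowns are the entries of a matrix [M] followed by those of its inverse
   [M']; the generators are the entries of [M M' - 1], of [f(M' A)] and [h(M A)]. *)
Definition negative_cert : Type :=
  seq (poly_data * (nat * nat)) * (seq (poly_data * point_item) * seq (poly_data * point_item)).

Definition negative_valid (z : nat * system_data * system_data) (c : negative_cert) : bool :=
  all (fun l => point_ok z.1.1 z.2 l.2.1) c.2.1 && all (fun l => point_ok z.1.1 z.1.2 l.2.1) c.2.2.

(** The equations of the first subscheme are tested through [M'] at points of the second, and those
    of the second through [M] at points of the first. *)
Definition negative_total (z : nat * system_data * system_data) (c : negative_cert) W : nat :=
  let r := z.1.1 in let m := (r * r + r * r)%N in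
  sumc ([seq mulc (peval m l.1 W) (inverse_value r W l.2) | l <- c.1] ++
        ([seq mulc (peval m l.1 W) (point_value r z.1.2 (r * r) W l.2) | l <- c.2.1] ++
         [seq mulc (peval m l.1 W) (point_value r z.2 0 W l.2) | l <- c.2.2])).

(** The 2 in [D] is the degree of the entries of [M M' - 1]. *)
Definition negative_ok (z : nat * system_data * system_data) (c : negative_cert) : bool :=
  let D := (enc c + (enc z.1.2 + enc z.2) + 2)%N in
  negative_valid z c &&
  all (fun W => nu (negative_total z c W) == nu onec) (grid D (z.1.1 * z.1.1 + z.1.1 * z.1.1)).

Lemma nu_negative_total z c W : nu (negative_total z c W) =
  let r := z.1.1 in let P p := (poly_of nu (r * r + r * r) p).@[@coord _ W] in
  \sum_(l <- c.1) P l.1 * nu (inverse_value r W l.2) +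
  (\sum_(l <- c.2.1) P l.1 * nu (point_value r z.1.2 (r * r) W l.2) +
   \sum_(l <- c.2.2) P l.1 * nu (point_value r z.2 0 W l.2)).
Proof.
rewrite nu_sumc !big_cat !big_map /=.
by congr (_ + (_ + _)); apply: eq_bigr => l _; rewrite nuM nu_peval.
Qed.

(** * Polynomial functions of the unknowns *)

Section PolynomialFunctions.
Context (m : nat).

(** The generators exist only as programs acting on [W]; this supplies the polynomial and the degree
    bound that the grid test and the Nullstellensatz call for. *)
Definition polyfun d (phi : seq nat -> algC) : Prop :=
  exists2 e : {mpoly algC[m]}, deg_le d e & forall W, phi W = e.@[@coord m W].

Lemma polyfun_ext d phi psi : phi =1 psi -> polyfun d phi -> polyfun d psi.
Proof. by move=> eq [e de eE]; exists e => // W; rewrite -eq eE. Qed.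

Lemma polyfunW d e phi : (d <= e)%N -> polyfun d phi -> polyfun e phi.
Proof. by move=> le [p dp pE]; exists p => //; apply: deg_leW dp. Qed.

Lemma polyfunC d c : polyfun d (fun=> c).
Proof. by exists c%:MP => [|W]; [apply: deg_leC | rewrite mevalC]. Qed.

Lemma polyfun_coord i : (i < m)%N -> polyfun 1 (fun W => nu (nth zeroc W i)).
Proof.
by move=> lti; exists 'X_(Ordinal lti) => [|W]; [apply: deg_leX | rewrite mevalXU].
Qed.

Lemma polyfunD d phi psi : polyfun d phi -> polyfun d psi -> polyfun d (fun W => phi W + psi W).
Proof.
move=> [p dp pE] [q dq qE]; exists (p + q) => [|W]; first exact: deg_leD.
by rewrite mevalD pE qE.
Qed.

Lemma polyfunM d e phi psi :
  polyfun d phi -> polyfun e psi -> polyfun (d + e) (fun W => phi W * psi W).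
Proof.
move=> [p dp pE] [q dq qE]; exists (p * q) => [|W]; first exact: deg_leM.
by rewrite mevalM pE qE.
Qed.

Lemma polyfunZ d c phi : polyfun d phi -> polyfun d (fun W => c * phi W).
Proof. exact: (polyfunM (polyfunC 0 c)). Qed.

Lemma polyfun_sum d (T : eqType) (s : seq T) (phi : T -> seq nat -> algC) :
  (forall i, i \in s -> polyfun d (phi i)) -> polyfun d (fun W => \sum_(i <- s) phi i W).
Proof.
elim: s => [|i s IHs] dphi.
  by apply: polyfun_ext (polyfunC d 0) => W; rewrite big_nil.
have di := dphi i (mem_head i s).
have ds : polyfun d (fun W => \sum_(j <- s) phi j W).
  by apply: IHs => j js; apply: dphi; rewrite inE js orbT.
by apply: polyfun_ext (polyfunD di ds) => W; rewrite big_cons.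
Qed.

Definition mx_polyfun n d (Phi : seq nat -> 'M[algC]_n) : Prop :=
  forall u v, polyfun d (fun W => Phi W u v).

Lemma mx_polyfunM n d e (Phi Psi : seq nat -> 'M_n) :
  mx_polyfun d Phi -> mx_polyfun e Psi -> mx_polyfun (d + e) (fun W => Phi W *m Psi W).
Proof.
move=> dPhi dPsi u v.
apply: (polyfun_ext (phi := fun W => \sum_(j <- index_enum 'I_n) Phi W u j * Psi W j v)).
  by move=> W; rewrite mxE.
by apply: polyfun_sum => j _; apply: polyfunM.
Qed.

Lemma mx_polyfunX n d N (Phi : seq nat -> 'M_n.+1) :
  mx_polyfun d Phi -> mx_polyfun (N * d) (fun W => Phi W ^+ N).
Proof.
move=> dPhi; elim: N => [|N IHN] u v.
  by apply: polyfun_ext (polyfunC _ ((1 : 'M_n.+1) u v)) => W; rewrite expr0.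
by apply: polyfun_ext (mx_polyfunM dPhi IHN u v) => W; rewrite exprS.
Qed.

Lemma mx_polyfun_prod n (T : Type) (s : seq T) (d : T -> nat) (Phi : T -> seq nat -> 'M_n.+1) :
    (forall i, mx_polyfun (d i) (Phi i)) ->
  mx_polyfun (\sum_(i <- s) d i) (fun W => \prod_(i <- s) Phi i W).
Proof.
move=> dPhi; elim: s => [|i s IHs] u v.
  by apply: polyfun_ext (polyfunC _ ((1 : 'M_n.+1) u v)) => W; rewrite big_nil.
rewrite big_cons.
by apply: polyfun_ext (mx_polyfunM (dPhi i) IHs u v) => W; rewrite big_cons.
Qed.

Lemma polyfun_subgrid r o : (o + r * r <= m)%N ->
  mx_polyfun 1 (fun W => mxof r (subgrid r o W)).
Proof.
move=> le_m u v.
apply: (polyfun_ext (phi := fun W => nu (nth zeroc W (o + (u * r + v))))).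
  by move=> W; rewrite mxof_mkmx mxE.
apply: polyfun_coord; apply: leq_trans le_m; rewrite ltn_add2l.
apply: leq_trans (_ : u.+1 * r <= _)%N; last by rewrite leq_mul2r ltn_ord orbT.
by rewrite mulSn addnC ltn_add2r ltn_ord.
Qed.

Lemma mx_polyfun_meval n r (A : 'I_r -> 'M[algC]_n.+1) (M : seq nat -> 'M_r) (p : poly_data) :
    mx_polyfun 1 M ->
  mx_polyfun (enc p) (fun W => mx_meval (lin_mx (M W) A) (poly_of nu r p)).
Proof.
move=> dM u v.
apply: (polyfun_ext (phi := fun W => \sum_(t <- p) nu t.1 *
   (\prod_i lin_mx (M W) A i ^+ nth 0%N t.2 i) u v)).
  move=> W; rewrite /poly_of mx_meval_sum summxE; apply: eq_bigr => t _.
  rewrite mx_mevalZ mxE mx_mevalX.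
  by under [in RHS]eq_bigr do rewrite mnmE.
apply: (polyfun_sum (T := (nat * seq nat)%type)) => t tp; apply: polyfunZ; apply: (polyfunW (term_deg_enc r tp)).
apply: (@mx_polyfun_prod _ _ _ (fun i : 'I_r => nth 0%N t.2 i)) => i {u v}.
rewrite -[X in mx_polyfun X]muln1; apply: mx_polyfunX => u v.
apply: (polyfun_ext (phi := fun W => \sum_(j <- index_enum 'I_r) A j u v * M W i j)).
  by move=> W; rewrite /lin_mx summxE; apply: eq_bigr => j _; rewrite mxE mulrC.
by apply: polyfun_sum => j _; apply: polyfunZ; apply: dM.
Qed.

End PolynomialFunctions.

Lemma entry_mx_sum n s u v : ~~ ((u < n)%N && (v < n)%N) -> entry (mx_sum n s) u v = zeroc.
Proof. by move=> /negPf out; case: s => [|A s]; rewrite /= entry_mkmx out. Qed.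

(** An index out of range in a certificate yields the generator zero, which does no harm. *)
Lemma point_valueE r F o W l :
  nu (point_value r F o W l) =
  if insub l.2.2.1 is Some u then if insub l.2.2.2 is Some v then
    mx_meval (lin_mx (mxof r (subgrid r o W)) (@mxs_of l.1.1.+1 r l.1.2.1))
      (poly_of nu r (nth [::] F l.2.1)) u v else 0 else 0.
Proof.
rewrite /point_value; case: l => [[n [As T]] [f [u v]]] /=.
case: insubP => [u' ltu uE|out]; last by rewrite entry_mx_sum ?nu0 // negb_and out.
case: insubP => [v' ltv vE|out]; last by rewrite entry_mx_sum ?nu0 // negb_and out orbT.
rewrite -(eq_mx_meval _ (mxs_of_comb _ _ _)) -mxof_poly mxE.
by rewrite uE vE.
Qed.

Lemma inverse_valueE r W uv :
  nu (inverse_value r W uv) =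
  if insub uv.1 is Some u then if insub uv.2 is Some v then
    (mxof r (subgrid r 0 W) *m mxof r (subgrid r (r * r) W) - 1%:M) u v else 0 else 0.
Proof.
rewrite /inverse_value; case: uv => u v /=.
case: insubP => [u' ltu uE|/negPf out]; last by rewrite entry_mkmx out nu0.
case: insubP => [v' ltv vE|/negPf out]; last by rewrite entry_mkmx out andbF nu0.
rewrite -mxof_mul -mxof_one -scaleN1r -nuN1 -mxof_scale -mxof_add mxE.
by rewrite uE vE.
Qed.


Lemma polyfun_inverse_value r uv :
  polyfun (r * r + r * r) 2 (fun W => nu (inverse_value r W uv)).
Proof.
apply: (polyfun_ext (fun W => esym (inverse_valueE r W uv))).
case: insubP => [u _ _|_]; last exact: polyfunC.
case: insubP => [v _ _|_]; last exact: polyfunC.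
have dprod := mx_polyfunM (polyfun_subgrid (leq_addr (r * r) (0 + r * r)))
  (polyfun_subgrid (leqnn (r * r + r * r))).
apply: polyfun_ext (polyfunD (dprod u v) (polyfunC _ _ (- (1%:M : 'M_r) u v))) => W.
by rewrite !mxE.
Qed.

(** The matrices of the point are constants, so the degree in the unknowns is bounded by that of the
    equation, whatever the point. *)
Lemma polyfun_point_value r F o l : (o + r * r <= r * r + r * r)%N ->
  polyfun (r * r + r * r) (enc F) (fun W => nu (point_value r F o W l)).
Proof.
move=> le_o; apply: (polyfun_ext (fun W => esym (point_valueE r F o W l))).
case: insubP => [u _ _|_]; last exact: polyfunC.
case: insubP => [v _ _|_]; last exact: polyfunC.
apply: polyfunW (mx_polyfun_meval _ _ (polyfun_subgrid le_o) u v).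
case: (ltnP l.2.1 (size F)) => ltl; first exact/enc_mem/mem_nth.
by rewrite nth_default.
Qed.

Lemma polyfun_peval m p d : (enc p <= d)%N ->
  polyfun m d (fun W => (poly_of nu m p).@[@coord m W]).
Proof. by move=> led; exists (poly_of nu m p) => //; apply: deg_leW (deg_le_poly_of _ _). Qed.

Lemma polyfun_negative_total z c :
  polyfun (z.1.1 * z.1.1 + z.1.1 * z.1.1) (enc c + (enc z.1.2 + enc z.2) + 2)
    (fun W => nu (negative_total z c W)).
Proof.
apply: (polyfun_ext (fun W => esym (nu_negative_total z c W))) => /=.
have item (T : eqType) (cT : coded T) (s : seq (poly_data * T)) (val : seq nat -> T -> nat) e d :
    (enc s <= e)%N -> (forall t, polyfun (z.1.1 * z.1.1 + z.1.1 * z.1.1) d (fun W => nu (val W t))) ->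
  polyfun (z.1.1 * z.1.1 + z.1.1 * z.1.1) (e + d)
    (fun W => \sum_(l <- s) (poly_of nu _ l.1).@[@coord (z.1.1 * z.1.1 + z.1.1 * z.1.1) W] * nu (val W l.2)).
  move=> les dval; apply: polyfun_sum => l ls; apply: polyfunM (dval _).
  by apply: polyfun_peval; apply: leq_trans (enc_fst l) (leq_trans (enc_mem ls) les).
apply: polyfunD.
  apply: (polyfunW (d := enc c + 2)); first by rewrite leq_add2r leq_addr.
  apply: (item _ _ c.1 (fun W => inverse_value z.1.1 W)); first exact: enc_fst.
  exact: polyfun_inverse_value.
apply: polyfunD.
  apply: (polyfunW (d := enc c + enc z.1.2)); first by rewrite -!addnA leq_add2l leq_addr.
  apply: (item _ _ c.2.1 (fun W => point_value z.1.1 z.1.2 (z.1.1 * z.1.1) W)).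
    by apply: leq_trans (enc_snd c); apply: enc_fst.
  by move=> t; apply: polyfun_point_value.
apply: (polyfunW (d := enc c + enc z.2)).
  by rewrite -!addnA leq_add2l addnCA leq_addr.
apply: (item _ _ c.2.2 (fun W => point_value z.1.1 z.2 0 W)).
  by apply: leq_trans (enc_snd c); apply: enc_snd.
by move=> t; apply: polyfun_point_value; apply: leq_addr.
Qed.

Lemma subgrid_surj r (M M' : 'M[algC]_r) :
  exists W, mxof r (subgrid r 0 W) = M /\ mxof r (subgrid r (r * r) W) = M'.
Proof.
have [[C <-] [C' <-]] := (mxof_surj M, mxof_surj M').
pose f k := if (k < r * r)%N then entry C (k %/ r) (k %% r)
  else entry C' ((k - r * r) %/ r) ((k - r * r) %% r).
have lt2 (i j : 'I_r) : (i * r + j < r * r)%N.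
  apply: leq_trans (_ : i.+1 * r <= _)%N; last by rewrite leq_mul2r ltn_ord orbT.
  by rewrite mulSn addnC ltn_add2r ltn_ord.
have r0 (i : 'I_r) : (0 < r)%N by apply: leq_ltn_trans (ltn_ord i).
exists (mkseq f (r * r + r * r)); split; rewrite mxof_mkmx; apply/matrixP => i j; rewrite !mxE.
  rewrite nth_mkseq ?add0n ?(leq_trans (lt2 i j)) ?leq_addr // /f lt2.
  by rewrite divnMDl ?(r0 i) // modnMDl divn_small ?modn_small ?addn0.
rewrite nth_mkseq ?ltn_add2l // /f ltnNge leq_addr /= addKn.
by rewrite divnMDl ?(r0 i) // modnMDl divn_small ?modn_small ?addn0.
Qed.

Lemma point_value_eq0 r F G o W T l :
    included (mxof r (subgrid r o W)) (system_of nu r F) (system_of nu r G) ->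
  point_ok r G T -> nu (point_value r F o W (T, l)) = 0.
Proof.
move=> inc /point_ok_sound pt; rewrite point_valueE.
case: insubP => // u _ _; case: insubP => // v _ _ /=.
case: (ltnP l.1 (size F)) => ltl; last first.
  by rewrite nth_default // /poly_of big_nil /mx_meval mmap0 mxE.
by rewrite (included_matrix_point inc pt) ?mxE //; apply/map_f/mem_nth.
Qed.

(** The combination is 1 on the grid, hence everywhere by its degree, while all generators vanish at
    the matrices of an equivalence. *)
Lemma negative_ok_sound z c : negative_ok z c -> ~ instance_equiv z.
Proof.
case/andP => /andP[/allP valid1 /allP valid2] /allP gridP [M [M' [MM' inc' inc]]].
have [e de eE] := polyfun_negative_total z c.
have {}eE W : nu (negative_total z c W) = 1.
  rewrite eE; suff -> : e = 1 by rewrite meval1.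
  apply/eqP; rewrite -subr_eq0; apply/eqP; apply: grid_eq0 => [|X /gridP/eqP totalX].
    by apply: deg_leD de _; apply: deg_leN; apply: deg_le1.
  by rewrite mevalB meval1 -eE totalX nu1 subrr.
have [W [WM WM']] := subgrid_surj M M'.
have /eqP := eE W; rewrite nu_negative_total eq_sym /= !big1_seq ?addr0 ?oner_eq0 //.
- move=> l /= lc; case: l lc => p [T l] /valid2 /= pt.
  by rewrite (point_value_eq0 _ _ pt) ?mulr0 // WM.
- move=> l /= lc; case: l lc => p [T l] /valid1 /= pt.
  by rewrite (point_value_eq0 _ _ pt) ?mulr0 // WM'.
- move=> l /= _; rewrite inverse_valueE WM WM' MM' subrr.
  by case: insubP => [u _ _|_]; [case: insubP => [v _ _|_]|]; rewrite ?mxE mulr0.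
Qed.

(* The polynomials certified by some [c] form an ideal whose zeros are the
   pairs [(M, M')] that identify the two subschemes. *)
Lemma negative_ok_complete z : ~ instance_equiv z -> exists c, negative_ok z c.
Proof.
move=> nequiv; set m := (z.1.1 * z.1.1 + z.1.1 * z.1.1)%N.
pose J (p : {mpoly algC[m]}) := exists2 c, negative_valid z c &
  forall W, p.@[@coord m W] = nu (negative_total z c W).
suff [c valid cE] : J 1.
  by exists c; rewrite /negative_ok valid; apply/allP => W _; rewrite -cE meval1 nu1.
have idJ : ideal J.
  split.
  - by exists ([::], ([::], [::])) => // W; rewrite meval0 nu_negative_total /= !big_nil !addr0.
  - move=> p q [c vc cE] [d vd dE].
    exists (c.1 ++ d.1, (c.2.1 ++ d.2.1, c.2.2 ++ d.2.2)) => [|W].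
      move: vc vd; rewrite /negative_valid /= !all_cat.
      by move=> /andP[-> ->] /andP[-> ->].
    rewrite mevalD cE dE !nu_negative_total /= !big_cat /=.
    by rewrite addrACA [X in _ + X]addrACA.
  (* The multiplier is absorbed into the cofactors; the points, and thus validity, are untouched. *)
  - move=> a p [c vc cE].
    have [mulc' mulcE] := choice_fun (fun p => poly_of_surj (a * poly_of nu m p)).
    exists ([seq (mulc' l.1, l.2) | l <- c.1], ([seq (mulc' l.1, l.2) | l <- c.2.1],
       [seq (mulc' l.1, l.2) | l <- c.2.2])) => [|W].
      by move: vc; rewrite /negative_valid /= !all_map.
    rewrite mevalM cE !nu_negative_total /= !big_map !mulrDr !mulr_sumr.
    by congr (_ + (_ + _)); apply: eq_bigr => l _; rewrite mulcE mevalM mulrA.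
apply: NNPP => J1; apply: nequiv.
have [a aJ] := nullstellensatz idJ J1; have [W Wa] := coord_surj a.
(* [J] contains polynomials whereas generators are functions on codes; [polyfun] provides the
   polynomial that vanishes at [a]. *)
have zeroW (d : nat) phi : polyfun m d phi ->
    (exists2 c, negative_valid z c & forall W, phi W = nu (negative_total z c W)) -> phi W = 0.
  move=> [e _ eE] [c vc cE]; rewrite eE (meval_eq _ Wa); apply: aJ.
  by exists c => // V; rewrite -eE.
have [one oneE] := poly_of_surj (1 : {mpoly algC[m]}).
have inc o F G : (o = 0%N /\ F = z.2 /\ G = z.1.2) \/ (o = (z.1.1 * z.1.1)%N /\ F = z.1.2 /\ G = z.2) ->
  included (mxof z.1.1 (subgrid z.1.1 o W)) (system_of nu z.1.1 F) (system_of nu z.1.1 G).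
  move=> side; apply: matrix_point_included => n A _ ptA /(nthP 0)[f + <-].
  rewrite size_map => ltf; rewrite (nth_map [::]) //.
  have [As [w [ok AE]]] := point_ok_complete ptA.
  have linE : lin_mx (mxof z.1.1 (subgrid z.1.1 o W)) A =1
      lin_mx (mxof z.1.1 (subgrid z.1.1 o W)) (@mxs_of n.+1 z.1.1 As).
    by move=> i; apply: eq_bigr => j _; rewrite AE.
  rewrite (eq_mx_meval _ linE).
  apply/matrixP => u v; rewrite [RHS]mxE.
  pose l : point_item := ((n, (As, w)), (f, (nat_of_ord u, nat_of_ord v))).
  have := point_valueE z.1.1 F o W l; rewrite /= !valK => <-.
  have le_o : (o + z.1.1 * z.1.1 <= z.1.1 * z.1.1 + z.1.1 * z.1.1)%N.
    by case: side => [[-> _]|[-> _]]; rewrite ?leq_addr.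
  apply: (zeroW _ (fun W => nu (point_value z.1.1 F o W l)) (polyfun_point_value F l le_o)).
  case: side => [[-> [-> EG]]|[-> [-> EG]]]; rewrite EG in ok.
    exists ([::], ([::], [:: (one, l)])) => [|V]; first by rewrite /negative_valid /= ok.
    by rewrite nu_negative_total /= !big_nil big_seq1 !add0r /= oneE meval1 mul1r.
  exists ([::], ([:: (one, l)], [::])) => [|V]; first by rewrite /negative_valid /= ok.
  by rewrite nu_negative_total /= !big_nil big_seq1 add0r addr0 /= oneE meval1 mul1r.
exists (mxof z.1.1 (subgrid z.1.1 0 W)), (mxof z.1.1 (subgrid z.1.1 (z.1.1 * z.1.1) W)).
split; [|by apply: inc; right|by apply: inc; left].
apply/eqP; rewrite -subr_eq0; apply/eqP/matrixP => u v; rewrite [RHS]mxE.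
have := inverse_valueE z.1.1 W (nat_of_ord u, nat_of_ord v); rewrite /= !valK => <-.
apply: (zeroW _ (fun W => nu (inverse_value z.1.1 W (nat_of_ord u, nat_of_ord v)))
  (polyfun_inverse_value _ _)).
exists ([:: (one, (nat_of_ord u, nat_of_ord v))], ([::], [::])) => // V.
by rewrite nu_negative_total /= !big_nil big_seq1 !addr0 /= oneE meval1 mul1r.
Qed.


(** * Computability of the checkers *)

Hypotheses
  (computable_addc : forall X (cX : coded X) (a b : X -> nat),
     computable a -> computable b -> computable (fun z => addc (a z) (b z)))
  (computable_mulc : forall X (cX : coded X) (a b : X -> nat),
     computable a -> computable b -> computable (fun z => mulc (a z) (b z)))
  (computable_eqc : forall X (cX : coded X) (a b : X -> nat),
     computable a -> computable b -> computable (fun z => nu (a z) == nu (b z))).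

Ltac computability_code ::= lazymatch goal with
  | |- computable (fun z => addc (@?a z) (@?b z)) => apply: computable_addc
  | |- computable (fun z => mulc (@?a z) (@?b z)) => apply: computable_mulc
  | |- computable (fun z => nu (@?a z) == nu (@?b z)) => apply: computable_eqc
  end.

Lemma computable_entry X (cX : coded X) A (i j : X -> nat) :
  computable A -> computable i -> computable j ->
  computable (fun z => entry (A z) (i z) (j z)).
Proof. by move=> cA ci cj; rewrite /entry; computability. Qed.

Lemma computable_mkmx X (cX : coded X) n (f : X -> nat -> nat -> nat) :
  computable n -> computable (fun p : X * nat * nat => f p.1.1 p.1.2 p.2) ->
  computable (fun z => mkmx (n z) (f z)).
Proof.
by move=> cn cf; rewrite /mkmx; computability.
Qed.

Lemma computable_sumc X (cX : coded X) (s : X -> seq nat) :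
  computable s -> computable (fun z => sumc (s z)).
Proof. by move=> cs; rewrite /sumc; computability. Qed.

Ltac computability_code ::= lazymatch goal with
  | |- computable (fun z => addc (@?a z) (@?b z)) => apply: computable_addc
  | |- computable (fun z => mulc (@?a z) (@?b z)) => apply: computable_mulc
  | |- computable (fun z => nu (@?a z) == nu (@?b z)) => apply: computable_eqc
  | |- computable (fun z => entry (@?A z) (@?i z) (@?j z)) => apply: computable_entry
  | |- computable (fun z => mkmx (@?n z) (@?f z)) => apply: computable_mkmx
  | |- computable (fun z => sumc (@?s z)) => apply: computable_sumc
  end.

Lemma computable_mx_add X (cX : coded X) (n : X -> nat) (A : X -> seq (seq nat)) (B : X -> seq (seq nat)) :
  computable n -> computable A -> computable B ->
  computable (fun z => mx_add (n z) (A z) (B z)).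
Proof. by move=> cn cA cB; rewrite /mx_add; computability. Qed.

Lemma computable_mx_mul X (cX : coded X) (n : X -> nat) (A : X -> seq (seq nat)) (B : X -> seq (seq nat)) :
  computable n -> computable A -> computable B ->
  computable (fun z => mx_mul (n z) (A z) (B z)).
Proof. by move=> cn cA cB; rewrite /mx_mul; computability. Qed.

Lemma computable_mx_scale X (cX : coded X) (n : X -> nat) (c : X -> nat) (A : X -> seq (seq nat)) :
  computable n -> computable c -> computable A ->
  computable (fun z => mx_scale (n z) (c z) (A z)).
Proof. by move=> cn cc cA; rewrite /mx_scale; computability. Qed.

Lemma computable_mx_one X (cX : coded X) (n : X -> nat) :
  computable n ->
  computable (fun z => mx_one (n z)).
Proof. by move=> cn; rewrite /mx_one; computability. Qed.

Lemma computable_mx_zero X (cX : coded X) (n : X -> nat) :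
  computable n ->
  computable (fun z => mx_zero (n z)).
Proof. by move=> cn; rewrite /mx_zero; computability. Qed.

Lemma computable_mx_eq X (cX : coded X) (n : X -> nat) (A : X -> seq (seq nat)) (B : X -> seq (seq nat)) :
  computable n -> computable A -> computable B ->
  computable (fun z => mx_eq (n z) (A z) (B z)).
Proof. by move=> cn cA cB; rewrite /mx_eq; computability. Qed.

Lemma computable_grid X (cX : coded X) (D : X -> nat) (m : X -> nat) :
  computable D -> computable m ->
  computable (fun z => grid (D z) (m z)).
Proof. by move=> cD cm; rewrite /grid /natc; computability. Qed.

Lemma computable_mx_comb X (cX : coded X) (n : X -> nat) (r : X -> nat) (M : X -> seq (seq nat)) (As : X -> seq (seq (seq nat))) :
  computable n -> computable r -> computable M -> computable As ->
  computable (fun z => mx_comb (n z) (r z) (M z) (As z)).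
Proof.
move=> cn cr cM cAs; rewrite /mx_comb /mx_sum /mx_add /mx_zero /mx_scale.
by computability.
Qed.

Lemma computable_mx_poly X (cX : coded X) (n : X -> nat) (r : X -> nat) (p : X -> poly_data) (As : X -> seq (seq (seq nat))) :
  computable n -> computable r -> computable p -> computable As ->
  computable (fun z => mx_poly (n z) (r z) (p z) (As z)).
Proof.
move=> cn cr cp cAs; rewrite /mx_poly /mx_sum /mx_prod /mx_exp /mx_add /mx_zero /mx_scale /mx_mul /mx_one.
by computability.
Qed.

Ltac computability_code ::= lazymatch goal with
  | |- computable (fun z => addc (@?a z) (@?b z)) => apply: computable_addc
  | |- computable (fun z => mulc (@?a z) (@?b z)) => apply: computable_mulc
  | |- computable (fun z => nu (@?a z) == nu (@?b z)) => apply: computable_eqc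
  | |- computable (fun z => entry (@?A z) (@?i z) (@?j z)) => apply: computable_entry
  | |- computable (fun z => mkmx (@?n z) (@?f z)) => apply: computable_mkmx
  | |- computable (fun z => sumc (@?s z)) => apply: computable_sumc
  | |- computable (fun z => mx_add (@?n z) (@?A z) (@?B z)) => apply: computable_mx_add
  | |- computable (fun z => mx_mul (@?n z) (@?A z) (@?B z)) => apply: computable_mx_mul
  | |- computable (fun z => mx_scale (@?n z) (@?c z) (@?A z)) => apply: computable_mx_scale
  | |- computable (fun z => mx_one (@?n z)) => apply: computable_mx_one
  | |- computable (fun z => mx_zero (@?n z)) => apply: computable_mx_zero
  | |- computable (fun z => mx_eq (@?n z) (@?A z) (@?B z)) => apply: computable_mx_eq
  | |- computable (fun z => grid (@?D z) (@?m z)) => apply: computable_grid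
  | |- computable (fun z => mx_comb (@?n z) (@?r z) (@?M z) (@?As z)) => apply: computable_mx_comb
  | |- computable (fun z => mx_poly (@?n z) (@?r z) (@?p z) (@?As z)) => apply: computable_mx_poly
  end.

Lemma computable_positive_ok X (cX : coded X) (x : X -> nat * system_data * system_data) (c : X -> positive_cert) :
  computable x -> computable c ->
  computable (fun z => positive_ok (x z) (c z)).
Proof.
move=> cx cc; rewrite /positive_ok /incl_ok /psubst /peval /expc /point_mx.
by computability.
Qed.

Lemma computable_negative_ok X (cX : coded X) (x : X -> nat * system_data * system_data) (c : X -> negative_cert) :
  computable x -> computable c ->
  computable (fun z => negative_ok (x z) (c z)).
Proof.
move=> cx cc; rewrite /negative_ok /negative_valid /negative_total /point_ok /peval /inverse_value /point_value /subgrid /point_mx.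
by computability.
Qed.

End Codes.

(** Post's argument: a property is decidable once it and its negation both have checkable
    certificates. Excluded middle makes the minimization regular. *)
Lemma decidable_by_search (X C C' : Type) (cX : coded X) (cC : coded C) (cC' : coded C')
    (P : X -> Prop) (ok : X -> C -> bool) (ok' : X -> C' -> bool) :
    computable (dec : nat -> X) -> computable (dec : nat -> C) ->
    computable (dec : nat -> C') ->
    computable (fun q : X * C => ok q.1 q.2) -> computable (fun q : X * C' => ok' q.1 q.2) ->
    (forall x, P x <-> exists c, ok x c) -> (forall x, ~ P x <-> exists c, ok' x c) ->
  exists2 h : nat -> nat, recursive1 h &
    forall x, (P x -> h (enc x) = 1%N) /\ (~ P x -> h (enc x) = 0%N).
Proof.
move=> dX dC dC' cok cok' posP negP.
(* The same number is read as a certificate of either kind, so a single minimization runs both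
   searches; testing [ok] again at the least hit gives the answer. *)
pose found x y := ok (@dec X cX x) (@dec C cC y) || ok' (@dec X cX x) (@dec C' cC' y).
have cokE : computable (fun q : nat * nat => ok (dec q.1) (dec q.2)).
  apply: (computable_comp cok (g := fun q : nat * nat => (dec q.1, dec q.2))).
  by apply: computable_pair; [apply: (computable_comp dX) | apply: (computable_comp dC)];
    computability.
have [B rB BE] : computable (fun q : nat * nat => found q.1 q.2).
  apply: computable_or => //.
  apply: (computable_comp cok' (g := fun q : nat * nat => (dec q.1, dec q.2))).
  by apply: computable_pair; [apply: (computable_comp dX) | apply: (computable_comp dC')];
    computability.
have [A rA AE] := cokE.
have /choice_fun[mu muP] x : exists y, found x y /\ forall y', found x y' -> ~ (y' < y)%N.
  have [|y fy ymin] := @wf_minimal _ _ _ id (found x) ltn_wf; last by exists y.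
  have [/posP[c okc]|/negP[c okc]] := classic (P (dec x)); exists (enc c).
    by rewrite /found encK okc.
  by rewrite /found encK okc orbT.
have rmu : recursive1 mu.
  apply: (@recursive_seq_mu 1 (fun s => 1 - B (cpair (nth 0 s 1) (nth 0 s 0)))%N).
  - apply: (recursive_seq_comp2 recursive2_sub (recursive_seq_const _ _)).
    apply: (recursive_seq_comp1 rB).
    by apply: (recursive_seq_comp2 recursive2_cpair); apply: recursive_seq_nth.
  - move=> [|x []] // _; have [fx _] := muP x.
    by have := BE (x, mu x); rewrite /= fx => <-.
  - move=> [|x []] //= y _ lty; have [_ ymin] := muP x.
    by have := BE (x, y); rewrite /=; case: (found x y) (ymin y) => [/(_ isT)//|_ <-].
exists (fun x => A (cpair x (mu x))).
  apply: (recursive_seq_comp1 rA).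
  exact: (recursive_seq_comp2 recursive2_cpair (recursive_seq_nth _ _) rmu).
move=> x; have := AE (enc x, mu (enc x)); rewrite /= => <-; rewrite encK.
have [+ _] := muP (enc x); rewrite /found encK => fx; split=> Px.
  case/orP: fx => [->//|okc]; have /negP : exists c, ok' x c by exists (dec (mu (enc x))).
  by [].
case E: (ok x _) => //; case: Px; apply/posP; by exists (dec (mu (enc x))).
Qed.

Lemma enc_system (F : system_data) : enc F = code_system F.
Proof.
congr CodeSeq.code; apply: eq_map => p; congr CodeSeq.code; apply: eq_map => -[c e].
by rewrite /code_term -cpair_code /=; congr cpair; congr CodeSeq.code; rewrite map_id.
Qed.

Lemma recursive2_tuple (f : 2.-tuple nat -> nat) :
  recursive f -> recursive2 (fun a b => f [tuple a; b]).
Proof.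
move=> rf; apply: recursive_ext rf _ => v; congr f; apply: val_inj => /=.
by case: v => -[|a [|b []]].
Qed.

Ltac computable_dec := repeat first
  [ exact: computable_dec_nat | apply: computable_dec_seq | apply: computable_dec_pair ].

Theorem proposition5p1 (nu : nat -> algC)
    (nu_computable : computable_representation nu) :
  exists2 decide : 3.-tuple nat -> nat, recursive decide &
    forall (r : nat) (F G : system_data),
      (0 < r)%N ->
      homogeneous_system (system_of nu r F) ->
      homogeneous_system (system_of nu r G) ->
      (projectively_equivalent (system_of nu r F) (system_of nu r G) ->
         decide [tuple r; code_system F; code_system G] = 1%N) /\
      (~ projectively_equivalent (system_of nu r F) (system_of nu r G) ->
         decide [tuple r; code_system F; code_system G] = 0%N).
Proof.
case: nu_computable => surj [e /recursive2_tuple re eE] [add /recursive2_tuple radd addE] _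
  [mul /recursive2_tuple rmul mulE] _.
(* These codes are merely known to exist; each becomes a constant of the algorithm. *)
have [[zero nu0] [[one nu1] [mone nuN1]]] := (surj 0, (surj 1, surj (-1))).
have cadd X (cX : coded X) (a b : X -> nat) : computable a -> computable b ->
    computable (fun z => add [tuple a z; b z]).
  by apply: (computable_op2 (f := fun a b => add [tuple a; b]) radd).
have cmul X (cX : coded X) (a b : X -> nat) : computable a -> computable b ->
    computable (fun z => mul [tuple a z; b z]).
  by apply: (computable_op2 (f := fun a b => mul [tuple a; b]) rmul).
have ceq X (cX : coded X) (a b : X -> nat) : computable a -> computable b ->
    computable (fun z => nu (a z) == nu (b z)).
  by apply: (computable_op2 (f := fun a b => nu a == nu b) re) => x y; rewrite eE.
pose addc a b := add [tuple a; b]; pose mulc a b := mul [tuple a; b].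
have [|||||||h rh hE] := @decidable_by_search _ _ _ _ _ _ (instance_equiv nu)
  (positive_ok nu addc mulc zero one) (negative_ok nu addc mulc zero one mone).
- by computable_dec.
- by computable_dec.
- by computable_dec.
- by apply: computable_positive_ok => //; computability.
- by apply: computable_negative_ok => //; computability.
- move=> z; split; first exact: (positive_ok_complete addE mulE nu0 nu1 surj).
  by case=> c; apply: (positive_ok_sound addE mulE nu0 nu1 surj).
- move=> z; split; first exact: (negative_ok_complete addE mulE nu0 nu1 nuN1 surj).
  by case=> c; apply: (negative_ok_sound addE mulE nu0 nu1 nuN1 surj).
have rc : recursive_seq 3 (fun s => cpair (cpair (nth 0 s 0) (nth 0 s 1)) (nth 0 s 2))%N.
  apply: (recursive_seq_comp2 recursive2_cpair); last exact: recursive_seq_nth.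
  by apply: (recursive_seq_comp2 recursive2_cpair); apply: recursive_seq_nth.
exists (fun v => h (cpair (cpair (nth 0 v 0) (nth 0 v 1)) (nth 0 v 2)))%N.
  exact: (recursive_seq_comp1 rh rc).
move=> r F G _ homF homG; have [pos neg] := hE (r, F, G).
rewrite /= -!enc_system; split=> [/(linearly_equivalentP homF homG)/pos//|nequiv].
by apply: neg => /(linearly_equivalentP homF homG).
Qed.
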